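(* Let $Y$ be a subgroup of $Z(SL_n(q))$ such that $1<|Y|_2<|\gcd(n,q-1)|_2$. Then the number of real conjugacy classes in $SL_n(q)/Y$ is equal to the number of strongly real conjugacy classes in $SL_n(q)/Y$, and is given by $$\sum_{|\nu|=n}h_\nu\, sl_\nu,$$ the sum being over all partitions $\nu$ of $n$.
   Context: An element $g$ of a group $G$ is real if $hgh^{-1}=g^{-1}$ for some $h\in G$, and strongly real if $h$ can be chosen with $h^2=1$; a class is (strongly) real if its elements are. For a positive integer $k$, $|k|_2$ is the largest power of $2$ dividing $k$; $|Y|_2$ is the largest power of $2$ dividing the order of $Y$. (The hypothesis forces $q\equiv1\pmod4$ and $n\equiv0\pmod 4$.) The notation $\nu=1^{n_1}2^{n_2}\cdots$ means the partition with $n_i$ parts equal to $i$. If $\nu$ has parts $\nu_1,\dots,\nu_r$ then $h_\nu=\gcd(q-1,\nu_1,\dots,\nu_r)$. For $q$ odd and $m\ge1$: $n_{q,m}=2q^{(m-1)/2}$ if $m$ is odd; $n_{q,m}=(q+1)q^{m/2-1}$ if $m$ is even. The number $sl_\nu$ is defined by: - $sl_\nu=\prod_{n_i>0}n_{q,n_i}$ if $n_i=0$ for all odd $i$; - $sl_\nu=\frac12\prod_{n_i>0}n_{q,n_i}$ if there exists $i$ with $i n_i$ odd; - $sl_\nu=f_\nu(q)\prod_{i\text{ odd},\,n_i>0}q^{n_i/2-1}\prod_{i\text{ even},\,n_i>0}n_{q,n_i}$ otherwise, where $f_\nu(q)=\frac{(q+1)^r+(q-1)^r}{2}$ and $r$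 here is the number of odd $i$ with $n_i>0$. *)

(* Defs.v *)
From mathcomp Require Import all_boot all_order all_algebra all_fingroup all_solvable.

Set Implicit Arguments.
Unset Strict Implicit.
Unset Printing Implicit Defensive.

Import GroupScope.

Definition real_elt (gT : finGroupType) (G : {set gT}) (g : gT) : bool :=
  [exists h in G, h * g * h^-1 == g^-1].

Definition strongly_real_elt (gT : finGroupType) (G : {set gT}) (g : gT) : bool :=
  [exists h in G, (h ^+ 2 == 1) && (h * g * h^-1 == g^-1)].

Definition real_classes (gT : finGroupType) (G : {set gT}) : {set {set gT}} :=
  [set C in classes G | [forall g in C, real_elt G g]].

Definition strongly_real_classes (gT : finGroupType) (G : {set gT}) :
    {set {set gT}} :=
  [set C in classes G | [forall g in C, strongly_real_elt G g]].

Section SpecialLinearGroup.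

Variables (n : nat) (F : finFieldType).

(* {'GL_n[F]} consists of matrices of size n.-1.+1, so this is the usual
   special linear group only for n > 0. *)
Definition SL : {set {'GL_n[F]}} :=
  [set g : {'GL_n[F]} | (\det (GLval g) == 1)%R].

Lemma group_set_SL : group_set SL.
Proof.
apply/group_setP; split=> [|x y]; rewrite !inE ?GL_1E ?GL_MxE ?det1 //.
by move=> /eqP dx /eqP dy; rewrite det_mulmx dx dy GRing.mulr1.
Qed.

Canonical SL_group : {group {'GL_n[F]}} := Group group_set_SL.

End SpecialLinearGroup.

Section Partitions.

Local Open Scope ring_scope.

Variables (n q : nat).

(* A partition 1^{n_1} 2^{n_2} ... of n is encoded by its multiplicities:
   nu i is the number n_i of parts equal to i. Parts and multiplicities are
   at most n; there are no parts equal to 0. *)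
Definition is_partition (nu : {ffun 'I_n.+1 -> 'I_n.+1}) : bool :=
  (nu ord0 == 0 :> nat)%N && (\sum_(i < n.+1) i * nu i == n)%N.

Implicit Type nu : {ffun 'I_n.+1 -> 'I_n.+1}.

Definition h_part nu : nat :=
  \big[gcdn/q.-1]_(i < n.+1 | (0 < nu i)%N) (i : nat).

Definition nq (m : nat) : rat :=
  if odd m then 2 * q%:R ^+ (m.-1)./2 else (q%:R + 1) * q%:R ^+ (m./2).-1.

Definition f_part nu : rat :=
  let r := #|[set i : 'I_n.+1 | odd i & (0 < nu i)%N]| in
  ((q%:R + 1) ^+ r + (q%:R - 1) ^+ r) / 2.

Definition sl_part nu : rat :=
  if [forall i : 'I_n.+1, odd i ==> (nu i == 0 :> nat)%N] then
    \prod_(i < n.+1 | (0 < nu i)%N) nq (nu i)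
  else if [exists i : 'I_n.+1, odd (i * nu i)] then
    2^-1 * \prod_(i < n.+1 | (0 < nu i)%N) nq (nu i)
  else
    f_part nu * \prod_(i < n.+1 | odd i && (0 < nu i)%N) q%:R ^+ ((nu i)./2).-1
              * \prod_(i < n.+1 | ~~ odd i && (0 < nu i)%N) nq (nu i).

End Partitions.

(* Main.v *)
Require Import Defs.
From mathcomp Require Import all_boot all_order all_algebra all_fingroup all_solvable.
From mathcomp Require Import finfield qpoly qfpoly ring zify.

(* Grouping the elementary divisors of g in GL_n(q) by exponent, i.e. setting
   u_i to be the product of the irreducible phi over all elementary divisors
   phi^i of g, identifies the conjugacy classes of GL_n(q) with the families
   (u_i) of monic polynomials with nonzero constant term such that
   sum_i i deg(u_i) = n.  Inversion replaces every u_i by its reciprocal, so a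
   class is real exactly when all u_i are self-reciprocal.  The determinants of
   the centraliser of g are the h-th powers in the multiplicative group of F_q,
   where h is the gcd of the i such that u_i <> 1: for the upper bound, the
   determinant of a commuting z is the product of its determinants on the
   socles S_k, the intersection of im r(g)^k and ker r(g) with r the radical,
   and S_k = S_(k+1) when no exponent equals k+1.  Hence a class of GL_n(q)
   inside SL_n(q) splits into gcd(q-1, h) classes.  When 4 divides n, a real
   element of SL_n(q) is inverted by an involution of determinant 1: reversing
   a companion basis inverts a self-reciprocal block, and either some block has
   odd size, so that the sign can be adjusted, or the determinant is
   (-1)^(n/2) = 1.  Counting self-reciprocal polynomials then yields the number
   of real classes of SL_n(q).

   The hypotheses on Y provide a central alpha in SL_n(q) of order 2|Y| with
   Y generated by alpha^2.  Translating g by powers of alpha shows that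
   h g h^-1 = g^-1 y has the same number of solutions (g, h) for all y in Y, so
   SL_n(q)/Y and SL_n(q) have the same number of real classes. *)

(** Counting pairs replaces any splitting of individual classes: in a finite group the pairs (g, h)
    with h g h^-1 g = 1 number the group order times the number of real classes. This form passes to
    the quotient by comparing fibres, and over SL_n(q) it turns the splitting of a class of GL_n(q)
    into the index of the determinants of a centraliser.

    That index also needs enough determinants. On a block phi^i, a polynomial in the companion
    matrix has as determinant the i-th power of a norm from F[X]/phi, and the norm is onto because
    it maps a generator of the larger multiplicative group to one of the smaller.

    A self-reciprocal polynomial has constant term 1 or -1, so for real types determinant 1 is a
    condition on signs. Averaging 1 and the product of the signs detects it, and both resulting sums
    factor over the exponents. This average is the source of the 1/2 and of the two terms in f_nu.

    Strong reality comes along: the inverting elements constructed in SL_n(q) have square 1, and a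
    real element modulo Y is first moved by a power of alpha to an element real in SL_n(q). *)

Set Implicit Arguments.
Unset Strict Implicit.
Unset Printing Implicit Defensive.

Import GRing.Theory.
Import Pdiv.Field.
Local Open Scope ring_scope.

(** * Polynomials in a matrix, similarity, and direct summands *)

Section Similarity.

Variable F : fieldType.

(* Like [kermxpoly], total in the size of the matrix. *)
Definition hornermx n (g : 'M[F]_n) (p : {poly F}) : 'M[F]_n :=
  (if n is n'.+1 then horner_mx^~ p : 'M_n'.+1 -> 'M_n'.+1 else fun=> 0) g.

Lemma hornermxS n (g : 'M[F]_n.+1) p : hornermx g p = horner_mx g p.
Proof. by []. Qed.

Lemma hornermxM n (g : 'M[F]_n) p q :
  hornermx g (p * q) = hornermx g p *m hornermx g q.
Proof. by case: n g => [|n] g; rewrite ?[LHS]flatmx0 ?[RHS]flatmx0 // !hornermxS rmorphM. Qed.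

Lemma hornermxD n (g : 'M[F]_n) p q :
  hornermx g (p + q) = hornermx g p + hornermx g q.
Proof. by case: n g => [|n] g; rewrite ?[LHS]flatmx0 ?[RHS]flatmx0 // !hornermxS rmorphD. Qed.

Lemma hornermxZ n (g : 'M[F]_n) a p : hornermx g (a *: p) = a *: hornermx g p.
Proof. by case: n g => [|n] g; rewrite ?[LHS]flatmx0 ?[RHS]flatmx0 // !hornermxS linearZ. Qed.

Lemma hornermxC n (g : 'M[F]_n) a : hornermx g a%:P = a%:M.
Proof. by case: n g => [|n] g; rewrite ?[LHS]flatmx0 ?[RHS]flatmx0 // hornermxS horner_mx_C. Qed.

Lemma hornermx0 n (g : 'M[F]_n) : hornermx g 0 = 0.
Proof. by rewrite -(scale0r 0) hornermxZ scale0r. Qed.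

Lemma hornermx1 n (g : 'M[F]_n) : hornermx g 1 = 1%:M.
Proof. by rewrite -[1 in LHS]/(1%:P) hornermxC. Qed.

Lemma hornermxX n (g : 'M[F]_n) : hornermx g 'X = g.
Proof. by case: n g => [|n] g; rewrite ?[LHS]flatmx0 ?[RHS]flatmx0 // hornermxS horner_mx_X. Qed.

Lemma hornermx_sum n (g : 'M[F]_n) (I : Type) (r : seq I) (P : pred I) (E : I -> {poly F}) :
  hornermx g (\sum_(i <- r | P i) E i) = \sum_(i <- r | P i) hornermx g (E i).
Proof. exact: (big_morph _ (hornermxD g) (hornermx0 g)). Qed.

Lemma hornermx_comm n (g : 'M[F]_n) p q :
  hornermx g p *m hornermx g q = hornermx g q *m hornermx g p.
Proof. by rewrite -!hornermxM mulrC. Qed.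

Lemma hornermx_intertwine m n (A : 'M[F]_m) (B : 'M[F]_n) (P : 'M[F]_(m, n)) p :
  P *m B = A *m P -> P *m hornermx B p = hornermx A p *m P.
Proof.
move=> PB; elim/poly_ind: p => [|p c IH]; first by rewrite !hornermx0 mulmx0 mul0mx.
rewrite !hornermxD !hornermxC !hornermxM !hornermxX mulmxDr mulmxDl.
by rewrite mulmxA IH -mulmxA PB mulmxA scalar_mxC.
Qed.

Lemma hornermx_block m n (A : 'M[F]_m) (B : 'M[F]_n) p :
  hornermx (block_mx A 0 0 B) p = block_mx (hornermx A p) 0 0 (hornermx B p).
Proof.
elim/poly_ind: p => [|p c IH]; first by rewrite !hornermx0 block_mx0.
rewrite !hornermxD !hornermxC !hornermxM !hornermxX IH mulmx_block.
by rewrite !mul0mx !mulmx0 !addr0 !add0r scalar_mx_block add_block_mx !addr0.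
Qed.

(* Similarity of matrices whose sizes are only provably equal, so that block
   decompositions need no casts. *)
Definition hsim m n (A : 'M[F]_m) (B : 'M[F]_n) : Prop :=
  exists P : 'M[F]_(m, n), exists Q : 'M[F]_(n, m),
    [/\ P *m Q = 1%:M, Q *m P = 1%:M & P *m B = A *m P].

Lemma hsim_refl n (A : 'M[F]_n) : hsim A A.
Proof. by exists 1%:M, 1%:M; rewrite !mulmx1 mul1mx. Qed.

Lemma hsim_sym m n (A : 'M[F]_m) (B : 'M[F]_n) : hsim A B -> hsim B A.
Proof.
case=> P [Q [PQ QP PB]]; exists Q, P; split=> //.
by rewrite -[B in RHS]mul1mx -QP -(mulmxA Q) PB -!mulmxA PQ mulmx1.
Qed.

Lemma hsim_trans l m n (A : 'M[F]_l) (B : 'M[F]_m) (C : 'M[F]_n) :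
  hsim A B -> hsim B C -> hsim A C.
Proof.
case=> P [Q [PQ QP PB]] [R [S [RS SR RC]]]; exists (P *m R), (S *m Q); split.
- by rewrite mulmxA -(mulmxA P) RS mulmx1.
- by rewrite mulmxA -(mulmxA S) QP mulmx1.
- by rewrite -mulmxA RC !mulmxA PB.
Qed.

Lemma hsim_size m n (A : 'M[F]_m) (B : 'M[F]_n) : hsim A B -> m = n.
Proof.
case=> P [Q [PQ QP _]]; apply/eqP; rewrite eqn_leq; apply/andP; split.
  by rewrite -(mxrank1 F m) -PQ mulmx_max_rank.
by rewrite -(mxrank1 F n) -QP mulmx_max_rank.
Qed.

Lemma hsim_det m n (A : 'M[F]_m) (B : 'M[F]_n) : hsim A B -> \det A = \det B.
Proof.
move=> AB; have e := hsim_size AB; case: _ / e B AB => B [P [Q [PQ QP PB]]].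
have/eqP := congr1 determinant PB; rewrite !det_mulmx mulrC.
move/eqP/mulIf => -> //.
by apply: contra_eq_neq (congr1 determinant PQ) => P0; rewrite det_mulmx P0 mul0r det1 eq_sym oner_neq0.
Qed.

Lemma hsim_rank m n (A : 'M[F]_m) (B : 'M[F]_n) : hsim A B -> \rank A = \rank B.
Proof.
move=> AB; have e := hsim_size AB; case: _ / e B AB => B [P [Q [PQ QP PB]]].
have Pu : P \in unitmx by case/mulmx1_unit: PQ.
by rewrite -(mxrankMfree A (B := P)) ?row_free_unit // -PB eqmxMfull // row_full_unit.
Qed.

Lemma hsim_hornermx m n (A : 'M[F]_m) (B : 'M[F]_n) p :
  hsim A B -> hsim (hornermx A p) (hornermx B p).
Proof. by case=> P [Q [PQ QP PB]]; exists P, Q; split=> //; apply: hornermx_intertwine. Qed.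

Lemma hsim_block m n m' n' (A : 'M[F]_m) (B : 'M[F]_n) (A' : 'M[F]_m') (B' : 'M[F]_n') :
  hsim A A' -> hsim B B' -> hsim (block_mx A 0 0 B) (block_mx A' 0 0 B').
Proof.
case=> P [Q [PQ QP PB]] [R [S [RS SR RC]]].
exists (block_mx P 0 0 R), (block_mx Q 0 0 S).
rewrite !mulmx_block !(mul0mx, mulmx0, addr0, add0r).
by rewrite PQ QP RS SR PB RC -!scalar_mx_block.
Qed.

Lemma hsim_swap m n (A : 'M[F]_m) (B : 'M[F]_n) :
  hsim (block_mx A 0 0 B) (block_mx B 0 0 A).
Proof.
exists (block_mx 0 1%:M 1%:M 0), (block_mx 0 1%:M 1%:M 0).
by rewrite !mulmx_block !(mul0mx, mulmx0, addr0, add0r, mul1mx, mulmx1) -!scalar_mx_block.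
Qed.

Lemma hsim_cast m n (e : m = n) (A : 'M[F]_m) : hsim A (castmx (e, e) A).
Proof. by case: _ / e; rewrite castmx_id; apply: hsim_refl. Qed.

Lemma hsim_assoc l m n (A : 'M[F]_l) (B : 'M[F]_m) (C : 'M[F]_n) :
  hsim (block_mx A 0 0 (block_mx B 0 0 C)) (block_mx (block_mx A 0 0 B) 0 0 C).
Proof.
have := block_mxA (A11 := A) (A12 := 0 : 'M_(l, m)) (A13 := 0 : 'M_(l, n)) (A21 := 0 : 'M_(m, l))
  (A22 := B) (A23 := 0) (A31 := 0 : 'M_(n, l)) (A32 := 0 : 'M_(n,m)) (A33 := C).
rewrite /= !col_mx0 !row_mx0 => ->.
exact/hsim_sym/hsim_cast.
Qed.

Lemma hsim_exchange l m n (A : 'M[F]_l) (B : 'M[F]_m) (C : 'M[F]_n) :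
  hsim (block_mx A 0 0 (block_mx B 0 0 C)) (block_mx B 0 0 (block_mx A 0 0 C)).
Proof.
apply: hsim_trans (hsim_assoc _ _ _) _; apply: hsim_trans (hsim_sym (hsim_assoc _ _ _)).
exact: hsim_block (hsim_swap _ _) (hsim_refl _).
Qed.

(** [M *m K] is an idempotent commuting with [g]. The space is the sum of its image, where [g] acts
    as [c], and of the image of the complementary idempotent [f]; a rank factorisation [S *m R] of
    [f] satisfies [R *m S = 1%:M] and gives coordinates on the latter. *)
Lemma hsim_idempotent m n (g : 'M[F]_n) (c : 'M[F]_m) (K : 'M[F]_(m, n)) (M : 'M[F]_(n, m)) :
  K *m M = 1%:M -> K *m g = c *m K -> g *m M = M *m c ->
  exists n' (g' : 'M[F]_n'), hsim g (block_mx c 0 0 g').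
Proof.
move=> KM Kg gM; pose f := 1%:M - M *m K.
have ff : f *m f = f.
  rewrite /f mulmxBl mul1mx mulmxBr mulmx1 -mulmxA (mulmxA K) KM mul1mx.
  by rewrite subrr subr0.
have fM : f *m M = 0 by rewrite mulmxBl mul1mx -mulmxA KM mulmx1 subrr.
have Kf : K *m f = 0 by rewrite mulmxBr mulmx1 mulmxA KM mul1mx subrr.
have fg : f *m g = g *m f.
  by rewrite mulmxBl mulmxBr mul1mx mulmx1 -mulmxA Kg !mulmxA gM.
pose S := col_base f; pose R := row_base f.
have SR : S *m R = f by apply: mulmx_base.
have Sfull : forall k (X Y : 'M_(\rank f, k)), S *m X = S *m Y -> X = Y.
  by move=> k X Y; apply: (row_full_inj (col_base_full f)).
have Rfree : forall k (X Y : 'M_(k, \rank f)), X *m R = Y *m R -> X = Y.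
  by move=> k X Y; apply: (row_free_inj (row_base_free f)).
have RS : R *m S = 1%:M.
  by apply: Sfull; apply: Rfree; rewrite mulmx1 mulmxA SR -mulmxA SR ff.
have RM : R *m M = 0 by apply: Sfull; rewrite mulmxA SR fM mulmx0.
have KS : K *m S = 0 by apply: Rfree; rewrite -mulmxA SR Kf mul0mx.
have fR : R *m f = R by rewrite -[X in R *m X]SR mulmxA RS mul1mx.
exists (\rank f), (R *m g *m S); apply: hsim_sym.
exists (col_mx K R), (row_mx M S); split.
- by rewrite mul_col_row KM KS RM RS -scalar_mx_block.
- by rewrite mul_row_col SR /f addrC subrK.
- rewrite mul_col_mx mul_block_col !mul0mx addr0 add0r Kg.
  by rewrite -[X in _ = col_mx _ X](mulmxA (R *m g) S R) SR -(mulmxA R g) -fg mulmxA fR.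
Qed.

End Similarity.

(** * Companion matrices as cyclic modules F[X]/p *)

Section Companion.

Variable F : fieldType.
Implicit Types p q a b c phi : {poly F}.

Lemma hsim_block0 m n (A : 'M[F]_m) (B : 'M[F]_n) : m = 0 -> hsim B (block_mx A 0 0 B).
Proof.
move=> m0; subst m; rewrite [A]flatmx0.
exists (row_mx 0 1%:M), (col_mx 0 1%:M).
rewrite mul_row_col mul_col_row mul_row_block !(mul0mx, mulmx0, mul1mx, mulmx1) !(add0r, addr0).
rewrite mul_mx_row mulmx0 mulmx1; split=> //.
by rewrite [RHS]scalar_mx_block [X in block_mx X]flatmx0 [in RHS]flatmx0; congr block_mx; rewrite ?flatmx0 //.
Qed.

Lemma monic_size p : p \is monic -> size p = (size p).-1.+1.
Proof. by move/monic_neq0; rewrite -size_poly_gt0; case: (size p). Qed.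

Lemma monic_deg0 p : p \is monic -> (size p).-1 = 0 -> p = 1.
Proof.
move=> mp p0; have /size1_polyC pC : (size p <= 1)%N by rewrite monic_size // p0.
by move: mp; rewrite pC monicE lead_coefC => /eqP ->.
Qed.

(** With row vectors, [companionmx p] is multiplication by ['X] on F[X]/p in the basis of powers of
    ['X], and [poly_rV 1] is the cyclic vector. *)
Lemma companion_coordX p (i : 'I_(size p).-1) :
  poly_rV 1 *m hornermx (companionmx p) 'X^i = delta_mx 0 i :> 'rV_(size p).-1.
Proof.
case: i => i; elim: i => [|i IH] iD.
  rewrite expr0 hornermx1 mulmx1; apply/rowP=> j; rewrite !mxE coef1.
  by [].
rewrite [nat_of_ord _]/= exprSr hornermxM mulmxA hornermxX (IH (ltnW iD)).
exact: (@mulmx_delta_companion _ p (Ordinal (ltnW iD)) iD).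
Qed.

Lemma companion_coord_small p a : (size a <= (size p).-1)%N ->
  poly_rV 1 *m hornermx (companionmx p) a = poly_rV a :> 'rV_(size p).-1.
Proof.
move=> sa; have def_a : a = \sum_(i < (size p).-1) a`_i *: 'X^i.
  rewrite -poly_def; apply/polyP => i; rewrite coef_poly; case: ltnP => // h.
  by rewrite nth_default // (leq_trans sa).
rewrite [in LHS]def_a hornermx_sum mulmx_sumr.
rewrite [RHS]row_sum_delta; apply: eq_bigr => i _.
by rewrite hornermxZ -scalemxAr companion_coordX mxE.
Qed.

Lemma companion_annihilated p : p \is monic -> hornermx (companionmx p) p = 0.
Proof.
move=> mp; rewrite -[X in hornermx _ X](companionmxK mp); move: (companionmx p).
case: (size p).-1 => [|n] A; first by rewrite [hornermx _ _]flatmx0.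
exact: Cayley_Hamilton.
Qed.

Lemma hornermx_mod n (g : 'M[F]_n) (p a : {poly F}) :
  hornermx g p = 0 -> hornermx g (a %% p) = hornermx g a.
Proof. by move=> gp0; rewrite [a in RHS](divp_eq a p) hornermxD hornermxM gp0 mulmx0 add0r. Qed.

Lemma size_modp_monic p a : p \is monic -> (size (a %% p)%R <= (size p).-1)%N.
Proof. by move=> mp; rewrite -ltnS -monic_size // ltn_modp monic_neq0. Qed.

Lemma companion_coord p a : p \is monic ->
  poly_rV 1 *m hornermx (companionmx p) a = poly_rV (a %% p) :> 'rV_(size p).-1.
Proof.
move=> mp; rewrite -[RHS]companion_coord_small ?size_modp_monic //.
by rewrite hornermx_mod // companion_annihilated.
Qed.

Lemma companion_coord_eq0 p a : p \is monic ->
  (poly_rV 1 *m hornermx (companionmx p) a == 0 :> 'rV_(size p).-1) = (p %| a).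
Proof.
move=> mp; rewrite companion_coord //; apply/eqP/modp_eq0P => [e|->].
  by rewrite -[LHS](poly_rV_K (size_modp_monic a mp)) e linear0.
by rewrite linear0.
Qed.

Lemma hornermx_companion_eq0 p a : p \is monic ->
  (hornermx (companionmx p) a == 0) = (p %| a).
Proof.
move=> mp; apply/eqP/idP=> [e|/dvdpP [q ->]].
  by rewrite -companion_coord_eq0 // e mulmx0.
by rewrite hornermxM companion_annihilated // mulmx0.
Qed.

Definition krylovmx d n (g : 'M[F]_n) (v : 'rV[F]_n) : 'M[F]_(d, n) :=
  \matrix_(i < d) (v *m hornermx g 'X^i).

Lemma mul_krylovmx d n (g : 'M[F]_n) (v : 'rV[F]_n) (u : 'rV_d) :
  u *m krylovmx d g v = v *m hornermx g (rVpoly u).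
Proof.
rewrite mulmx_sum_row [rVpoly u]poly_def hornermx_sum mulmx_sumr.
by apply: eq_bigr => i _; rewrite rowK hornermxZ -scalemxAr valK.
Qed.

Lemma vec_hornermx_mod n (g : 'M[F]_n) (v : 'rV_n) p a :
  v *m hornermx g p = 0 -> v *m hornermx g (a %% p) = v *m hornermx g a.
Proof.
move=> vp0; rewrite [a in RHS](divp_eq a p) hornermxD mulmxDr mulrC hornermxM.
by rewrite mulmxA vp0 mul0mx add0r.
Qed.

(** As [p] kills [v], mapping a polynomial [c] to [v *m hornermx g c] is well defined on F[X]/p and
    F[X]-linear; the Krylov matrix is the matrix of this map. *)
Lemma krylovmx_companion n (g : 'M[F]_n) (v : 'rV[F]_n) p : p \is monic ->
  v *m hornermx g p = 0 ->
  krylovmx (size p).-1 g v *m g = companionmx p *m krylovmx (size p).-1 g v.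
Proof.
move=> mp vp0; apply/row_matrixP => i; rewrite !row_mul rowK.
have -> : row i (companionmx p) = poly_rV (modp 'X^(i.+1) p) :> 'rV_(size p).-1.
  by rewrite -companion_coord // exprSr hornermxM hornermxX mulmxA
             companion_coordX -rowE.
rewrite mul_krylovmx poly_rV_K ?size_modp_monic //.
by rewrite vec_hornermx_mod // exprSr hornermxM hornermxX mulmxA.
Qed.

Lemma krylovmx_free n (g : 'M[F]_n) (v : 'rV[F]_n) p : p \is monic ->
  (forall c, v *m hornermx g c = 0 -> p %| c) ->
  row_free (krylovmx (size p).-1 g v).
Proof.
move=> mp vann; rewrite -kermx_eq0; apply/eqP/row_matrixP => i; rewrite row0.
set u := row i _; have : u *m krylovmx (size p).-1 g v = 0.
  by rewrite /u -row_mul mulmx_ker row0.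
rewrite mul_krylovmx => /vann pu; apply: (can_inj (@rVpolyK _ _)).
rewrite linear0; apply: contraTeq pu => u0.
have su : (size (rVpoly u) <= (size p).-1)%N by apply: size_poly.
rewrite gtNdvdp //; apply: leq_ltn_trans su _; by rewrite [X in (_ < X)%N](monic_size mp).
Qed.

Lemma hornermx_tr n (g : 'M[F]_n) p : hornermx g^T p = (hornermx g p)^T.
Proof.
elim/poly_ind: p => [|p c IH]; first by rewrite !hornermx0 trmx0.
rewrite [in RHS]mulrC !hornermxD !hornermxC !hornermxM !hornermxX IH linearD /=.
by rewrite trmx_mul tr_scalar_mx.
Qed.

(** An equivariant retraction onto the cyclic module of [v] is built by duality. The form [l] reads
    the top coordinate on the Krylov basis of [w], and the columns of [M] are the translates of [l']
    by powers of [g]. Twisting by [b] makes [p] kill [l'], because [p * b] kills [g]. Then [K *m M]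
    is the matrix of the pairing of [a] and [c] in F[X]/p given by the top coefficient of [a * c]
    modulo [p], which is nondegenerate. *)
Lemma cyclic_split n (g : 'M[F]_n) (v : 'rV[F]_n) p b :
    p \is monic -> hornermx g (p * b) = 0 -> v *m hornermx g p = 0 ->
    (forall c, v *m hornermx g (b * c) = 0 -> p %| c) ->
  exists n' (g' : 'M[F]_n'), hsim g (block_mx (companionmx p) 0 0 g').
Proof.
move=> mp pb0 vp0 vann; set d := (size p).-1.
have [d0|d0] := posnP d.
  by exists n, g; apply: hsim_block0.
pose w := v *m hornermx g b.
have wann c : w *m hornermx g c = 0 -> p %| c.
  by rewrite /w -mulmxA -hornermxM; apply: vann.
have wp0 : w *m hornermx g p = 0.
  by rewrite /w -mulmxA hornermx_comm mulmxA vp0 mul0mx.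
have Wfree := krylovmx_free mp wann.
have [B WB] : exists B, krylovmx d g w *m B = 1%:M by case/row_freeP: Wfree => B; exists B.
have dP : (d.-1 < d)%N by rewrite prednK.
pose l := B *m delta_mx (Ordinal dP) 0 : 'cV_n.
have wl c : (size c <= d)%N -> w *m hornermx g c *m l = (c`_d.-1)%:M.
  move=> sc; rewrite -{1}(poly_rV_K sc) -mul_krylovmx -mulmxA (mulmxA _ B) WB mul1mx.
  by rewrite -colE; apply/matrixP=> i j; rewrite !ord1 !mxE.
pose K := krylovmx d g v.
pose l' := hornermx g b *m l.
pose M := (krylovmx d g^T l'^T)^T.
have Kg : K *m g = companionmx p *m K by apply: krylovmx_companion.
have gM : g *m M = M *m (companionmx p)^T.
  rewrite -[g]trmxK -!trmx_mul; congr (_^T); apply: krylovmx_companion => //.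
  by rewrite hornermx_tr -trmx_mul /l' mulmxA -hornermxM pb0 mul0mx trmx0.
have Ml (u : 'rV_d) : M *m u^T = hornermx g (rVpoly u) *m l'.
  by rewrite -trmx_mul mul_krylovmx hornermx_tr -trmx_mul trmxK.
have KM_free : row_free (K *m M).
  rewrite -kermx_eq0; apply/eqP/row_matrixP => i; rewrite row0.
  set u := row i _; have uKM : u *m K *m M = 0.
    by rewrite /u -mulmxA -row_mul mulmx_ker row0.
  apply: (can_inj (@rVpolyK _ _)); rewrite linear0; apply/eqP.
  apply: contraTT isT => u0; set a := rVpoly u in u0.
  have sa : (size a <= d)%N by apply: size_poly.
  have a_gt0 : (0 < size a)%N by rewrite size_poly_gt0.
  (* Pairing with this power of ['X] raises the degree of [a] to exactly [d.-1], so that the form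
     returns the leading coefficient of [a]. *)
  have /(congr1 (mulmx^~ (poly_rV 'X^(d - size a) : 'rV_d)^T)) := uKM.
  rewrite mul0mx -(mulmxA _ M) Ml poly_rV_K; last by rewrite size_polyXn; lia.
  rewrite mul_krylovmx -/a /l' 2!mulmxA.
  have -> : v *m hornermx g a *m hornermx g 'X^(d - size a) *m hornermx g b
    = w *m hornermx g (a * 'X^(d - size a)).
    by rewrite /w -!mulmxA -!hornermxM mulrA [in RHS]mulrC.
  rewrite wl; last first.
    by rewrite (leq_trans (size_polyMleq _ _)) // size_polyXn; lia.
  rewrite coefMXn ifF; last by apply/negbTE; lia.
  have -> : (d.-1 - (d - size a) = (size a).-1)%N by lia.
  move/matrixP/(_ 0 0); rewrite !mxE mulr1n => /eqP.
  by rewrite -lead_coefE lead_coef_eq0 (negPf u0).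
have : K *m M \in unitmx by rewrite -row_free_unit.
set U := K *m M => Uu; pose N := M *m invmx U.
have KN : K *m N = 1%:M by rewrite mulmxA mulmxV.
apply: (hsim_idempotent KN Kg).
(* [g] acts on the columns of [N] through a conjugate of the transposed companion matrix;
   [K *m N = 1%:M] forces that conjugate to be [companionmx p] itself. *)
pose c' := U *m (companionmx p)^T *m invmx U.
have gN : g *m N = N *m c'.
  by rewrite /N /c' mulmxA gM (mulmxA (M *m _)) (mulmxA (M *m _)) mulmxKV.
have c'E : c' = companionmx p by rewrite -[LHS]mul1mx -KN -mulmxA -gN mulmxA Kg -mulmxA KN mulmx1.
by rewrite -[X in _ = _ *m X]c'E.
Qed.
End Companion.

(** * Existence of elementary divisors, and ranks on primary blocks *)

Section PrimaryDecomposition.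

Variable F : finFieldType.
Implicit Types p q a b c d e phi psi : {poly F}.

Definition monic_irreducible phi := phi \is monic /\ irreducible_poly phi.

Lemma irreducible_factor phi c : irreducible_poly phi -> c != 0 ->
  exists j c', c = phi ^+ j * c' /\ coprimep phi c'.
Proof.
move=> irr; have [n] := ubnP (size c); elim: n c => // n IH c sc c0.
have [/dvdpP [d cE]|nd] := boolP (phi %| c); last first.
  by exists 0%N, c; rewrite expr0 mul1r; split=> //; rewrite irreducible_poly_coprime.
have d0 : d != 0 by apply: contraNneq c0 => d0; rewrite cE d0 mul0r.
have phi0 := irredp_neq0 irr.
have sd : (size d < n)%N.
  have := size_mul d0 phi0; rewrite -cE; case: irr => s1 _; move: s1 sc.
  have : (0 < size d)%N by rewrite size_poly_gt0.
  by move: (size d) (size phi) (size c) => x y z; lia.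
have [j [c' [dE cop]]] := IH d sd d0.
by exists j.+1, c'; rewrite cE dE exprSr mulrAC.
Qed.

Lemma exists_irreducible p : (1 < size p)%N -> exists phi, monic_irreducible phi /\ phi %| p.
Proof.
move=> s1; have p0 : p != 0 by rewrite -size_poly_gt0 ltnW.
(* Divisors are encoded as row vectors to make their existence a boolean predicate, as the search
   for a minimal size requires. *)
pose P m := [exists u : 'rV[F]_(size p),
  [&& size (rVpoly u) == m, (1 < m)%N & rVpoly u %| p]].
have exP : exists m, P m.
  exists (size p); apply/existsP; exists (poly_rV p).
  by rewrite poly_rV_K ?leqnn // eqxx s1 dvdpp.
case: (ex_minnP exP) => m /existsP [u /and3P [/eqP sq m1 qp]] minm.
set q := rVpoly u in sq qp; have q0 : q != 0 by rewrite -size_poly_gt0 sq ltnW.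
have lq0 : (lead_coef q)^-1 != 0 by rewrite invr_eq0 lead_coef_eq0.
exists ((lead_coef q)^-1 *: q); split; last by rewrite dvdpZl.
split; first by rewrite monicE lead_coefZ mulVf // lead_coef_eq0.
split=> [|d sd]; first by rewrite size_scale // sq.
rewrite dvdpZr // => dq; apply: (@eqp_trans _ q); last by rewrite eqp_sym eqp_scale.
rewrite -dvdp_size_eqp // eqn_leq.
rewrite dvdp_leq //= sq minm //; apply/existsP; exists (poly_rV d).
have d0 : d != 0 by apply: contraTneq dq => ->; rewrite dvd0p.
rewrite poly_rV_K ?(dvdp_trans dq qp) ?eqxx ?andbT; last first.
  by rewrite dvdp_leq // (dvdp_trans dq qp).
by move: d0 sd; rewrite -size_poly_gt0; case: (size d) => [|[|]].
Qed.

(** Let the minimal polynomial be [phi ^+ k * b] with [b] prime to [phi]. By minimality its quotient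
    [c] by [phi] does not kill every row; for a basis row [x] that it does not kill, the vector
    [x *m hornermx g b] has annihilator generated by [phi ^+ k] and [cyclic_split] applies. *)
Lemma primary_split n (g : 'M[F]_n) : (0 < n)%N ->
  exists phi k n' (g' : 'M[F]_n'), [/\ monic_irreducible phi, (0 < k)%N
    & hsim g (block_mx (companionmx (phi ^+ k)) 0 0 g')].
Proof.
case: n g => // n g _; set m := mxminpoly g.
have mm : m \is monic := mxminpoly_monic g.
have m0 := monic_neq0 mm.
have m_min c : (m %| c) = (hornermx g c == 0) by rewrite dvd_mxminpoly.
have s1 : (1 < size m)%N by rewrite size_mxminpoly ltnS mxminpoly_nonconstant.
have [phi [[mphi irr] phim]] := exists_irreducible s1.
have [k [b [mE cop]]] := irreducible_factor irr m0.
have k0 : (0 < k)%N.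
  case: k mE => //; rewrite expr0 mul1r => mE.
  by move: cop; rewrite irreducible_poly_coprime // -mE phim.
pose c := phi ^+ k.-1 * b.
have mc : m = phi * c by rewrite mE /c mulrA -exprS prednK.
have c0 : c != 0 by apply: contraNneq m0 => c0; rewrite mc c0 mulr0.
have : hornermx g c != 0.
  rewrite -m_min mc -[X in _ %| X]mul1r dvdp_mul2r // dvdp1.
  by case: irr; case: (size phi) => [|[]].
move=> gc0; have [i xi0] : exists i, row i (hornermx g c) != 0.
  apply/existsP; rewrite -negb_forall; apply: contra gc0 => /forallP e.
  by apply/eqP/row_matrixP => i; rewrite row0 (eqP (e i)).
rewrite rowE in xi0; set x := delta_mx 0 i in xi0.
have gm0 : hornermx g m = 0 by apply: mx_root_minpoly.
exists phi, k.
have [||||d [g' sim]] := @cyclic_split _ _ g (x *m hornermx g b) (phi ^+ k) b.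
- exact: monic_exp.
- by rewrite -mE.
- by rewrite -mulmxA -hornermxM mulrC -mE gm0 mulmx0.
- move=> d; rewrite -mulmxA -hornermxM => xd0.
  have [->|d0] := eqVneq d 0; first exact: dvdp0.
  have [j [d' [dE copd]]] := irreducible_factor irr d0.
  rewrite dE; case: (leqP k j) => [kj|jk]; first by rewrite dvdp_mulr // dvdp_exp2l.
  (* If [j < k], then [c] lies in the ideal generated by [b * (b * d)], which kills [x], and [m],
     which kills [g]; this contradicts the choice of [x]. *)
  case/eqP: xi0; have : coprimep (b * d') (phi ^+ k).
    by rewrite coprimep_expr // coprimepMl coprimep_sym cop coprimep_sym.
  case/Bezout_eq1_coprimepP => -[u1 u2] /= uE.
  have -> : c = b * (b * d) * (phi ^+ (k.-1 - j) * u1) + m * (phi ^+ k.-1 * u2).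
    rewrite /c -[LHS]mulr1 -uE mE dE.
    have -> : phi ^+ k.-1 = phi ^+ j * phi ^+ (k.-1 - j).
      by rewrite -exprD; congr (_ ^+ _); move: jk; case: (k) => // k' /=; lia.
    by ring.
  rewrite -hornermxS hornermxD (hornermxM _ m) gm0 mul0mx addr0.
  by rewrite (hornermxM _ (b * (b * d))) mulmxA xd0 mul0mx.
by exists d, g'.
Qed.

Fixpoint bdim (s : seq {poly F}) : nat :=
  if s is p :: s' then ((size p).-1 + bdim s')%N else 0%N.

Fixpoint bdiag (s : seq {poly F}) : 'M[F]_(bdim s) :=
  if s is p :: s' return 'M_(bdim s) then block_mx (companionmx p) 0 0 (bdiag s')
  else 0.

Implicit Types (s t : seq ({poly F} * nat)).

Definition elementary_divisors s := [seq x.1 ^+ x.2 | x <- s].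

Definition primary_type s :=
  forall x, x \in s -> monic_irreducible x.1 /\ (0 < x.2)%N.

Lemma primary_type_cons x s :
  primary_type (x :: s) <-> (monic_irreducible x.1 /\ (0 < x.2)%N) /\ primary_type s.
Proof.
split=> [H|[Hx Hs] y]; last by rewrite inE => /predU1P [->|/Hs].
by split=> [|y ys]; apply: H; rewrite inE ?eqxx ?ys ?orbT.
Qed.

Lemma primary_type_perm s t : perm_eq s t -> primary_type s -> primary_type t.
Proof. by move=> st Hs x; rewrite -(perm_mem st); apply: Hs. Qed.

Lemma primary_decomposition n (g : 'M[F]_n) :
  exists s, primary_type s /\ hsim g (bdiag (elementary_divisors s)).
Proof.
have [m] := ubnP n; elim: m n g => // m IH n g nm.
have [n0|n0] := posnP n.
  by subst n; exists [::]; split=> //; rewrite [g]flatmx0; apply: hsim_refl.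
have [phi [k [n' [g' [mirr k0 sim]]]]] := primary_split g n0.
have [|s [Hs sim']] := IH n' g'.
  have := hsim_size sim; case: mirr => mphi [s1 _].
  rewrite size_exp; have : (0 < (size phi).-1 * k)%N by rewrite muln_gt0 k0 andbT; case: (size phi) s1 => [|[]].
  by move: nm; move: ((size phi).-1 * k)%N => d; lia.
exists ((phi, k) :: s); split; first exact/primary_type_cons.
by apply: hsim_trans sim _; apply: hsim_block => //; apply: hsim_refl.
Qed.

Lemma bdiag_perm (s t : seq {poly F}) : perm_eq s t -> hsim (bdiag s) (bdiag t).
Proof.
elim: s t => [|p s IH] t.
  by move/perm_size; case: t => // _; apply: hsim_refl.
move=> pst; have pt : p \in t by rewrite -(perm_mem pst) mem_head.
have {pst IH} : hsim (bdiag s) (bdiag (rem p t)).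
  by apply: IH; rewrite -(perm_cons p) (permPl pst) perm_to_rem.
move/(hsim_block (hsim_refl (companionmx p)))/hsim_trans; apply.
elim: t pt => // q t IH; rewrite inE /=; case: (q =P p) => [->|/eqP qp]; first by move=> _; apply: hsim_refl.
rewrite eq_sym (negPf qp) /= => pt.
by apply: hsim_trans (hsim_exchange _ _ _) _; apply: hsim_block (IH pt); apply: hsim_refl.
Qed.

Lemma companion_unit p a : p \is monic -> coprimep a p ->
  hornermx (companionmx p) a \in unitmx.
Proof.
move=> mp /Bezout_eq1_coprimepP [[u v] /= uv1].
have : hornermx (companionmx p) (u * a) = 1%:M.
  have := congr1 (hornermx (companionmx p)) uv1.
  by rewrite hornermxD (hornermxM _ v) companion_annihilated // mulmx0 addr0 hornermx1.
by rewrite hornermxM => /mulmx1_unit [].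
Qed.

(** The image of the cyclic vector under [d] has annihilator [e], which bounds the rank below by the
    degree of [e]. Exchanging [d] and [e] gives the companion bound, and the vanishing product of
    the two matrices leaves no room for either rank to be larger. *)
Lemma rank_companion_dvd d e : d \is monic -> e \is monic ->
  \rank (hornermx (companionmx (d * e)%R) d) = (size e).-1.
Proof.
move=> md me; have lower a b : a \is monic -> b \is monic -> d * e = a * b ->
    ((size b).-1 <= \rank (hornermx (companionmx (d * e)%R) a))%N.
  move=> ma mb abE; set C := companionmx _.
  have free : row_free (krylovmx (size b).-1 C (poly_rV 1 *m hornermx C a)).
    apply: krylovmx_free => // c; rewrite -mulmxA -hornermxM => /eqP.
    by rewrite companion_coord_eq0 ?rpredM // abE dvdp_mul2l // monic_neq0.
  rewrite -(eqP free); apply: leq_trans (mxrankS (_ : (_ <= hornermx C a)%MS)) (leqnn _).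
  apply/row_subP => i; rewrite rowK -mulmxA -hornermxM (mulrC a) hornermxM mulmxA.
  exact: submxMl.
apply/eqP; rewrite eqn_leq (lower d e) // andbT.
have : hornermx (companionmx (d * e)) d *m hornermx (companionmx (d * e)) e = 0.
  by rewrite -hornermxM companion_annihilated ?rpredM.
move/mulmx0_rank_max; have := lower e d me md (mulrC _ _).
have : (size (d * e)).-1 = ((size d).-1 + (size e).-1)%N.
  by rewrite size_monicM ?monic_neq0 // (monic_size md) (monic_size me) /= addnS.
move: (\rank _) => r1; move: (\rank _) => r2 ->.
by move: (size d).-1 (size e).-1 => n1 n2; lia.
Qed.

Lemma rank_companion_primary phi a k j : monic_irreducible phi -> coprimep phi a ->
  \rank (hornermx (companionmx (phi ^+ j)) (phi ^+ k * a)%R) = ((size phi).-1 * (j - k))%N.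
Proof.
move=> [mphi irr] cop; rewrite hornermxM mxrankMfree; last first.
  by rewrite row_free_unit companion_unit ?monic_exp // coprimep_sym coprimep_expl.
rewrite -size_exp; case: (leqP k j) => [kj|jk].
  have := rank_companion_dvd (monic_exp k mphi) (monic_exp (j - k) mphi).
  by rewrite -exprD subnKC.
have -> : (j - k = 0)%N by lia.
rewrite expr0 size_poly1; apply/eqP; rewrite mxrank_eq0 hornermx_companion_eq0 ?monic_exp //.
by rewrite dvdp_exp2l // ltnW.
Qed.

End PrimaryDecomposition.

(** * Uniqueness of elementary divisors and their grouping by exponent *)

Section Invariants.

Variable F : finFieldType.
Implicit Types (p q a b c d e phi psi : {poly F}) (s t : seq ({poly F} * nat)).

Lemma monic_irreducible_coprime phi psi :
  monic_irreducible phi -> monic_irreducible psi -> phi != psi -> coprimep phi psi.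
Proof.
move=> [mphi irr] [mpsi [s1 irr']] neq; rewrite irreducible_poly_coprime //.
apply: contra neq => dvd; rewrite -eqp_monic //; apply: irr' => //.
by case: irr; case: (size phi) => [|[]].
Qed.

Lemma rank_bdiag (s : seq {poly F}) a :
  \rank (hornermx (bdiag s) a) = (\sum_(p <- s) \rank (hornermx (companionmx p) a))%N.
Proof.
elim: s => [|p s IH] /=; first by rewrite big_nil; apply/eqP; rewrite -leqn0 rank_leq_row.
by rewrite hornermx_block rank_diag_block_mx big_cons IH.
Qed.

(** On a block [phi ^+ j] the rank of [phi ^+ k] is the degree of [phi] times the truncated
    difference [j - k], which bends only at [k = j]; on other primes it is constant in [k]. The
    second difference therefore counts the blocks with [j = k.+1]. It is stated additively because
    subtraction on [nat] truncates. *)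
Lemma rank_second_difference s phi k : primary_type s -> monic_irreducible phi ->
  let f k := \rank (hornermx (bdiag (elementary_divisors s)) (phi ^+ k)) in
  (f k + f k.+2 = f k.+1 + f k.+1 + (size phi).-1 * count_mem (phi, k.+1) s)%N.
Proof.
move=> Hs irr f; rewrite /f !rank_bdiag !big_map; elim: s {f} Hs => [|x s IH].
  by rewrite !big_nil muln0.
case/primary_type_cons => -[irrx x2] /IH {}IH; rewrite !big_cons /=.
set g := fun k => \rank (hornermx (companionmx (x.1 ^+ x.2)) (phi ^+ k)).
suff xE : (g k + g k.+2 = g k.+1 + g k.+1 + (size phi).-1 * (x == (phi, k.+1)))%N.
  have lin (a b c A B C m n : nat) : (a + b = c + c + m -> A + B = C + C + n ->
      (a + A) + (b + B) = (c + C) + (c + C) + (m + n))%N by lia.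
  by rewrite mulnDr; apply: lin xE IH.
have [xphi|xphi] := eqVneq x.1 phi.
  have gE j : g j = ((size phi).-1 * (x.2 - j))%N.
    by rewrite /g -[phi ^+ j]mulr1 xphi rank_companion_primary ?coprimep1.
  rewrite !gE -!mulnDr; congr (_ * _)%N.
  have -> : (x == (phi, k.+1)) = (x.2 == k.+1) by rewrite -pair_eqE /pair_eq /= xphi eqxx.
  by case: eqP => /=; lia.
have gE j : g j = ((size x.1).-1 * x.2)%N.
  rewrite /g -[phi ^+ j]mul1r -(expr0 x.1) rank_companion_primary ?subn0 //.
  by rewrite coprimep_expr // monic_irreducible_coprime.
rewrite !gE; have -> : (x == (phi, k.+1)) = false; last by rewrite muln0 addn0.
by apply: contraNF xphi => /eqP ->.
Qed.

Lemma hsim_perm s t : primary_type s -> primary_type t ->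
  hsim (bdiag (elementary_divisors s)) (bdiag (elementary_divisors t)) -> perm_eq s t.
Proof.
move=> Hs Ht sim; apply/allP => x; rewrite mem_cat => xst.
have [irr x2] : monic_irreducible x.1 /\ (0 < x.2)%N by case/orP: xst => [/Hs|/Ht].
have rE k := hsim_rank (hsim_hornermx (x.1 ^+ k) sim).
have := rank_second_difference x.2.-1 Ht irr; rewrite /= -!rE.
rewrite (rank_second_difference x.2.-1 Hs irr) => /addnI /eqP.
rewrite prednK // -surjective_pairing eqn_mul2l => /orP [|//].
by case: irr => _ [s1 _]; case: (size x.1) s1 => [|[]].
Qed.

Definition type_poly s i : {poly F} := \prod_(x <- s | x.2 == i) x.1.

Lemma type_poly_cons x s i :
  type_poly (x :: s) i = (if x.2 == i then x.1 else 1) * type_poly s i.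
Proof. by rewrite /type_poly big_cons; case: eqP; rewrite ?mul1r. Qed.

Lemma type_poly_perm s t i : perm_eq s t -> type_poly s i = type_poly t i.
Proof. by move=> st; apply: perm_big. Qed.

Lemma type_poly_cat s t i : type_poly (s ++ t) i = type_poly s i * type_poly t i.
Proof. exact: big_cat. Qed.

Lemma type_poly_monic s i : primary_type s -> type_poly s i \is monic.
Proof.
move=> Hs; rewrite /type_poly big_seq_cond; apply: monic_prod => x /andP [xs _].
by case: (Hs x xs) => -[].
Qed.

Lemma irreducible_dvd_type_poly s phi i : primary_type s -> monic_irreducible phi ->
  phi %| type_poly s i -> (phi, i) \in s.
Proof.
move=> Hs irr; elim: s Hs => [|x s IH].
  rewrite /type_poly big_nil dvdp1 => _; case: irr => _ [s1 _].
  by case: (size phi) s1 => [|[]].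
case/primary_type_cons => -[irrx x2] /IH {}IH; rewrite type_poly_cons.
case: eqP => [xi|_]; last by rewrite mul1r inE => /IH ->; rewrite orbT.
have [->|neq] := eqVneq phi x.1; first by rewrite -xi -surjective_pairing mem_head.
rewrite inE.
by rewrite Gauss_dvdpr ?monic_irreducible_coprime // => /IH ->; rewrite orbT.
Qed.

(** Unique factorisation for each exponent: an irreducible factor of [type_poly t i] occurs in [t]
    with exponent [i], and can be cancelled on both sides. *)
Lemma type_poly_inj s t : primary_type s -> primary_type t ->
  type_poly s =1 type_poly t -> perm_eq s t.
Proof.
elim: s t => [|x s IH] t Hs Ht st.
  case: t Ht st => // x t /primary_type_cons [[[mx [s1 _]] _] Ht] /(_ x.2).
  rewrite type_poly_cons eqxx /type_poly big_nil => /(congr1 (fun p => size p)).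
  have m2 := type_poly_monic x.2 Ht.
  rewrite size_poly1 size_monicM ?monic_neq0 // (monic_size m2).
  by rewrite addnS /=; case: (size x.1) s1 => [|[|k]] // _; rewrite !addSn.
have [[irr x2] Hs'] := (primary_type_cons x s).1 Hs.
have xt : x \in t.
  rewrite [x]surjective_pairing; apply: irreducible_dvd_type_poly => //.
  by rewrite -st type_poly_cons eqxx dvdp_mulr.
have tx := perm_to_rem xt; rewrite (permPr tx) perm_cons.
have [_ Ht'] := (primary_type_cons _ _).1 (primary_type_perm tx Ht).
apply: IH => // i; have := st i; rewrite (type_poly_perm i tx) !type_poly_cons.
case: eqP => _; last by rewrite !mul1r.
by apply: mulfI; apply: irredp_neq0; case: irr.
Qed.

Lemma monic_factorization p : p \is monic ->
  exists l : seq {poly F}, (forall phi, phi \in l -> monic_irreducible phi) /\ p = \prod_(phi <- l) phi.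
Proof.
have [n] := ubnP (size p); elim: n p => // n IH p sp mp.
have [s1|p0] := ltnP 1 (size p); last first.
  exists [::]; split=> //; rewrite big_nil; apply: monic_deg0 => //.
  by case: (size p) p0 => [|[|]].
have [phi [irr /dvdpP [q pE]]] := exists_irreducible s1.
have mphi := irr.1; have mq : q \is monic by rewrite -(monicMr _ mphi) -pE.
have [|l [Hl qE]] := IH q _ mq.
  move: sp; rewrite pE size_monicM ?monic_neq0 //; case: irr => _ [+ _].
  have := monic_size mq.
  by move: (size q) (size phi) => x y; lia.
exists (phi :: l); split; last by rewrite big_cons pE qE mulrC.
by move=> psi; rewrite inE => /predU1P [->|/Hl].
Qed.

Lemma exists_type N (u : nat -> {poly F}) : (forall i, u i \is monic) ->
  exists s, primary_type s /\
    forall i, type_poly s i = if (0 < i <= N)%N then u i else 1.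
Proof.
move=> mu; elim: N => [|N [s [Hs sE]]].
  by exists [::]; split=> // i; rewrite /type_poly big_nil; case: i.
have [l [Hl uE]] := monic_factorization (mu N.+1).
exists ([seq (phi, N.+1) | phi <- l] ++ s); split.
  by move=> x; rewrite mem_cat => /orP [/mapP [phi /Hl irr ->]|/Hs].
move=> i; rewrite type_poly_cat sE {1}/type_poly big_map /=.
have [<-|neq] := eqVneq N.+1 i.
  by rewrite -uE leqnn ltnn andbF mulr1.
rewrite big_pred0_eq mul1r; congr (if _ then _ else _).
by move: neq; lia.
Qed.

(** For monic [p] this is the product of the roots, that is, the determinant of the companion
    matrix. *)
Definition signed_const p := (-1) ^+ (size p).-1 * p`_0.

Lemma signed_constM p q : p \is monic -> q \is monic ->
  signed_const (p * q) = signed_const p * signed_const q.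
Proof.
move=> mp mq; rewrite /signed_const size_monicM ?monic_neq0 //.
by rewrite (monic_size mp) (monic_size mq) /= addnS /= exprD coef0M mulrACA.
Qed.

Lemma signed_const1 : signed_const 1 = 1.
Proof. by rewrite /signed_const size_poly1 coef1 mulr1. Qed.

Lemma signed_constX p n : p \is monic -> signed_const (p ^+ n) = signed_const p ^+ n.
Proof.
move=> mp; elim: n => [|n IH]; first by rewrite !expr0 signed_const1.
by rewrite !exprS signed_constM ?monic_exp // IH.
Qed.

Lemma det_companion p : p \is monic -> \det (companionmx p) = signed_const p.
Proof.
move=> mp; have := char_poly_det (companionmx p); rewrite companionmxK // /signed_const => ->.
by rewrite mulrA -signr_odd -signr_addb addbb mul1r.
Qed.

Lemma type_bound s : primary_type s ->
  forall x, x \in s -> (x.2 <= bdim (elementary_divisors s))%N.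
Proof.
elim: s => // y s IH /primary_type_cons [[[my [s1 _]] y2] /IH {}IH] x.
rewrite inE /= size_exp => /predU1P [->|/IH].
  have : (y.2 <= (size y.1).-1 * y.2)%N by rewrite leq_pmull //; case: (size y.1) s1 => [|[]].
  by move=> h; apply: leq_trans h (leq_addr _ _).
by move=> h; apply: leq_trans h (leq_addl _ _).
Qed.

Lemma bdim_type s n : primary_type s -> (forall x, x \in s -> (x.2 <= n)%N) ->
  bdim (elementary_divisors s) = (\sum_(i < n.+1) i * (size (type_poly s i)).-1)%N.
Proof.
move=> Hs; elim: s Hs => [|x s IH] Hs Hn.
  by rewrite big1 // => i _; rewrite /type_poly big_nil size_poly1 muln0.
have /primary_type_cons [[[mx irr] x2] Hs'] := Hs.
have xn : (x.2 < n.+1)%N by apply: Hn; rewrite mem_head.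
rewrite /= IH //; last by move=> y ys; apply: Hn; rewrite inE ys orbT.
rewrite (bigD1 (Ordinal xn)) //= [RHS](bigD1 (Ordinal xn)) //= type_poly_cons eqxx.
rewrite addnA; congr (_ + _)%N; last first.
  apply: eq_bigr => i; rewrite -val_eqE /= type_poly_cons eq_sym => /negPf ->.
  by rewrite mul1r.
have m2 := type_poly_monic x.2 Hs'.
rewrite size_monicM ?monic_neq0 // size_exp (monic_size mx) (monic_size m2) addnS /=.
by rewrite mulnDr mulnC.
Qed.

Lemma det_type s n : primary_type s -> (forall x, x \in s -> (x.2 <= n)%N) ->
  \det (bdiag (elementary_divisors s)) = \prod_(i < n.+1) signed_const (type_poly s i) ^+ i.
Proof.
move=> Hs; elim: s Hs => [|x s IH] Hs Hn.
  rewrite det_mx00 big1 // => i _.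
  by rewrite /type_poly big_nil signed_const1 expr1n.
have /primary_type_cons [[[mx irr] x2] Hs'] := Hs.
have xn : (x.2 < n.+1)%N by apply: Hn; rewrite mem_head.
rewrite /= det_ublock IH //; last by move=> y ys; apply: Hn; rewrite inE ys orbT.
rewrite (bigD1 (Ordinal xn)) //= [RHS](bigD1 (Ordinal xn)) //= type_poly_cons eqxx.
rewrite mulrA; congr (_ * _); last first.
  apply: eq_bigr => i; rewrite -val_eqE /= type_poly_cons eq_sym => /negPf ->.
  by rewrite mul1r.
have m2 := type_poly_monic x.2 Hs'.
by rewrite det_companion ?monic_exp // signed_constX // (signed_constM mx m2) [RHS]exprMn.
Qed.

End Invariants.

(** * Reciprocal polynomials and inverses of companion matrices *)

Section Reciprocal.

Variable F : finFieldType.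
Implicit Types (p q a b c d e phi psi : {poly F}) (s t : seq ({poly F} * nat)).

(** X^d p(1/X) / p(0), with d the degree: the monic polynomial whose roots are the inverses of those
    of [p]. *)
Definition recip p := \poly_(i < size p) (p`_((size p).-1 - i) / p`_0).

Definition mpoly0 p := (p \is monic) && (p`_0 != 0).

Lemma size_recip p : mpoly0 p -> size (recip p) = size p.
Proof.
case/andP=> mp p0; rewrite /recip (monic_size mp) /=; apply: size_poly_eq.
by rewrite subnn divff // oner_neq0.
Qed.

Lemma coef_recip p i : mpoly0 p ->
  (recip p)`_i = if (i < size p)%N then p`_((size p).-1 - i) / p`_0 else 0.
Proof. by move=> _; rewrite coef_poly. Qed.

Lemma recip_coef0 p : mpoly0 p -> (recip p)`_0 = (p`_0)^-1.
Proof.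
move=> mp; rewrite coef_recip //; case/andP: mp => mp p0.
rewrite (monic_size mp) /= subn0.
by move: mp; rewrite monicE lead_coefE => /eqP ->; rewrite mul1r.
Qed.

Lemma recip_mpoly0 p : mpoly0 p -> mpoly0 (recip p).
Proof.
move=> mp; rewrite /mpoly0 recip_coef0 // monicE lead_coefE size_recip // coef_recip //.
case/andP: mp => mp p0; rewrite invr_eq0 p0 andbT ifT; last by rewrite (monic_size mp).
by rewrite subnn divff.
Qed.

Lemma recipK p : mpoly0 p -> recip (recip p) = p.
Proof.
move=> mp; apply/polyP => i; rewrite coef_recip ?recip_mpoly0 // size_recip //.
case: ltnP => [ip|pi]; last by rewrite nth_default.
rewrite recip_coef0 // coef_recip // invrK.
case/andP: mp => mp p0; rewrite ifT; last by move: ip; move: (size p) => n; lia.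
by rewrite divfK //; congr (_`_ _); move: ip; move: (size p) => n; lia.
Qed.

(* [p] is viewed in formal degree [n]: this is X^n p(1/X). *)
Definition reversal n p := \sum_(i < n.+1) p`_i *: 'X^(n - i).

Lemma reversal_poly n p : reversal n p = \poly_(i < n.+1) p`_(n - i).
Proof.
rewrite poly_def /reversal (reindex_inj rev_ord_inj) /=.
by apply: eq_bigr => i _; rewrite subSS subKn // -ltnS.
Qed.

Lemma recipE p : p \is monic -> recip p = (p`_0)^-1 *: reversal (size p).-1 p.
Proof.
move=> mp; rewrite reversal_poly -(monic_size mp); apply/polyP => i.
by rewrite coefZ !coef_poly; case: ifP; rewrite ?mulr0 // mulrC.
Qed.

Lemma reversal_lin n (x : F) p q : reversal n (x *: p + q) = x *: reversal n p + reversal n q.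
Proof.
rewrite /reversal scaler_sumr -big_split /=; apply: eq_bigr => i _.
by rewrite coefD coefZ scalerDl scalerA.
Qed.

Lemma reversal_sum n I (r : seq I) (P : pred I) (E : I -> {poly F}) :
  reversal n (\sum_(i <- r | P i) E i) = \sum_(i <- r | P i) reversal n (E i).
Proof.
apply: (big_morph (reversal n)) => [p q|].
  by rewrite -{1}[p]scale1r reversal_lin scale1r.
by rewrite /reversal big1 // => i _; rewrite coef0 scale0r.
Qed.

Lemma reversal_monomial n k (x : F) : (k <= n)%N -> reversal n (x *: 'X^k) = x *: 'X^(n - k).
Proof.
rewrite -ltnS => kn; rewrite /reversal (bigD1 (Ordinal kn)) //= coefZ coefXn eqxx mulr1.
rewrite big1 ?addr0 // => i; rewrite -val_eqE /= => ik.
by rewrite coefZ coefXn (negPf ik) mulr0 scale0r.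
Qed.

Lemma reversalM m n p q : (size p <= m.+1)%N -> (size q <= n.+1)%N ->
  reversal (m + n) (p * q) = reversal m p * reversal n q.
Proof.
have expand k a : (size a <= k.+1)%N -> a = \sum_(i < k.+1) a`_i *: 'X^i.
  move=> sa; rewrite -poly_def; apply/polyP => i; rewrite coef_poly; case: ltnP => // h.
  by rewrite nth_default // (leq_trans sa).
move=> sp sq; rewrite {1}(expand _ _ sp) {1}(expand _ _ sq) mulr_suml reversal_sum.
rewrite [in RHS]/reversal mulr_suml; apply: eq_bigr => i _.
rewrite !mulr_sumr reversal_sum; apply: eq_bigr => j _.
rewrite -!scalerAl -!scalerAr !scalerA -!exprD reversal_monomial; last first.
  by have := ltn_ord i; have := ltn_ord j; lia.
by congr (_ *: 'X^_); have := ltn_ord i; have := ltn_ord j; lia.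
Qed.

Lemma mpoly0M p q : mpoly0 p -> mpoly0 q -> mpoly0 (p * q).
Proof.
case/andP=> mp p0 /andP [mq q0].
by rewrite /mpoly0 rpredM // coef0M mulf_neq0.
Qed.

Lemma mpoly0_1 : mpoly0 1.
Proof. by rewrite /mpoly0 rpred1 coef1 oner_neq0. Qed.

Lemma recip1 : recip 1 = 1.
Proof.
by rewrite recipE ?rpred1 // size_poly1 coef1 invr1 scale1r /reversal big_ord1 coef1 scale1r.
Qed.

Lemma recipM p q : mpoly0 p -> mpoly0 q -> recip (p * q) = recip p * recip q.
Proof.
move=> hp hq; have /andP [mp p0] := hp; have /andP [mq q0] := hq.
rewrite !recipE ?rpredM // -scalerAl -scalerAr scalerA coef0M invfM; congr (_ *: _).
rewrite -reversalM -?monic_size // size_monicM ?monic_neq0 //.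
by rewrite (monic_size mp) (monic_size mq) /= addnS.
Qed.

Lemma mpoly0X p n : mpoly0 p -> mpoly0 (p ^+ n).
Proof. by move=> hp; elim: n => [|n IH]; rewrite ?expr0 ?mpoly0_1 // exprS mpoly0M. Qed.

Lemma recipX p n : mpoly0 p -> recip (p ^+ n) = recip p ^+ n.
Proof.
move=> hp; elim: n => [|n IH]; first by rewrite !expr0 recip1.
by rewrite !exprS recipM ?mpoly0X // IH.
Qed.

Lemma mpoly0_dvd p q : mpoly0 p -> q %| p -> q`_0 != 0.
Proof.
case/andP=> mp p0 /dvdpP [r pE]; move: p0; rewrite pE coef0M.
by apply: contraNneq => ->; rewrite mulr0.
Qed.

(** On monic polynomials with nonzero constant term [recip] is multiplicative and involutive, so a
    divisor of [recip phi], once made monic, yields a divisor of [phi] of the same degree. *)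
Lemma recip_irreducible phi : mpoly0 phi -> irreducible_poly phi -> irreducible_poly (recip phi).
Proof.
move=> hphi [s1 irr]; split=> [|d sd ddvd]; first by rewrite size_recip.
have hr := recip_mpoly0 hphi.
have d0 : d != 0 by apply: contraTneq ddvd => ->; rewrite dvd0p monic_neq0 // (andP hr).1.
wlog md : d d0 sd ddvd / d \is monic.
  have l0 : (lead_coef d)^-1 != 0 by rewrite invr_eq0 lead_coef_eq0.
  move=> W; have := W ((lead_coef d)^-1 *: d).
  rewrite scaler_eq0 (negPf l0) (negPf d0) size_scale // dvdpZl //.
  rewrite monicE lead_coefZ mulVf ?lead_coef_eq0 // => /(_ isT sd ddvd (eqxx _)).
  by apply: eqp_trans; rewrite eqp_sym eqp_scale.
have hd : mpoly0 d by rewrite /mpoly0 md (mpoly0_dvd hr).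
case/dvdpP: ddvd (ddvd) => e eE ddvd.
have he : mpoly0 e.
  rewrite /mpoly0 (mpoly0_dvd hr) ?andbT; last by rewrite eE dvdp_mulr.
  by rewrite -(monicMr _ md) -eE (andP hr).1.
have dvd' : recip d %| phi by rewrite -(recipK hphi) eE recipM // dvdp_mull.
have := irr (recip d); rewrite size_recip // => /(_ sd dvd') /eqp_size.
rewrite size_recip // => sE; rewrite -dvdp_size_eqp // sE size_recip //.
Qed.

Lemma recip_monic_irreducible phi :
  mpoly0 phi -> monic_irreducible phi -> monic_irreducible (recip phi).
Proof.
move=> hphi [_ irr]; split; last exact: recip_irreducible.
by case/andP: (recip_mpoly0 hphi).
Qed.

(* The matrix of the order-reversing permutation, once [m = n]. *)
Definition revmx m n : 'M[F]_(m, n) := \matrix_(i, j) ((i + j.+1)%N == n)%:R.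

Lemma revmxK m n : m = n -> revmx m n *m revmx n m = 1%:M.
Proof.
move=> <-; apply/matrixP => i j; rewrite !mxE (bigD1 (rev_ord i)) //= !mxE.
rewrite big1 ?addr0 => [|k]; last first.
  rewrite -val_eqE /= => ki; rewrite !mxE; case: eqP; rewrite ?mul0r // => e.
  by case/eqP: ki; have := ltn_ord i; lia.
rewrite -val_eqE /=; have hi := ltn_ord i.
have -> : (i + (m - i.+1).+1 == m)%N by apply/eqP; lia.
by rewrite mul1r; congr ((nat_of_bool _)%:R); apply/idP/idP; lia.
Qed.

(** On F[X]/p, multiplication by X^-1 shifts the basis of powers of X taken in reverse order, so in
    that order its matrix is the companion matrix of the reciprocal polynomial. *)
Lemma companion_recip p : mpoly0 p ->
  companionmx (recip p) *m revmx (size (recip p)).-1 (size p).-1 *m companionmx p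
  = revmx (size (recip p)).-1 (size p).-1.
Proof.
move=> hp; have sE := size_recip hp; have /andP [mp p0] := hp.
set q := recip p in sE *; have mE : (size q).-1 = (size p).-1 by rewrite sE.
set m := (size q).-1 in mE *; set n := (size p).-1 in mE *.
(* The last row of the companion matrix of [q] holds the coefficients of [p] backwards, and the
   reversal puts them back in order; the other rows are a reversed shift. *)
have CqP (i : 'I_m) (k : 'I_n) : (companionmx q *m revmx m n) i k =
    if i == n.-1 :> nat then - (p`_k.+1 / p`_0) else ((i.+1 + k.+1)%N == n)%:R.
  have lt : (n - k.+1 < m)%N by have := ltn_ord k; lia.
  rewrite mxE (bigD1 (Ordinal lt)) //= !mxE /= big1 ?addr0; last first.
    move=> l; rewrite -val_eqE /= => lk; rewrite !mxE [(_ == n)%N](_ : _ = false) ?mulr0 //.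
    by move: lk (ltn_ord k); lia.
  rewrite [(_ == n)%N](_ : _ = true) ?mulr1; last by apply/eqP; have := ltn_ord k; lia.
  have -> : (size q).-2 = n.-1 by rewrite -mE.
  case: ifP => [|_].
    move=> _; rewrite coef_recip // ifT; last first.
      by rewrite (monic_size mp) -/n; have := ltn_ord k; lia.
    by rewrite -/n subKn.
  have nat_eq (x y z : nat) : (y < z)%N -> (x.+1 == z - y.+1)%N = (x.+1 + y.+1 == z)%N by lia.
  by rewrite nat_eq.
apply/matrixP => i j; rewrite mxE [RHS]mxE.
have n0 : (n.-1 < n)%N by have := ltn_ord j; lia.
have np : n.-1.+1 = n by move: n0; case: (n).
have pn : p`_n = 1 by move: mp; rewrite monicE lead_coefE => /eqP.
(* In the last row the summand [k = n.-1] is [p_j / p_0], as [p] is monic. For [j > 0] the summand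
   [k = j - 1] cancels it; at [j = 0] it stays and equals 1. *)
have [ie|ie] := eqVneq (i : nat) n.-1.
  under eq_bigr => k _ do rewrite CqP ie eqxx.
  rewrite (bigD1 (Ordinal n0)) //= mxE eqxx /= np pn.
  rewrite mulrNN mul1r; case: j => -[|j] jn /=.
    rewrite big1 ?addr0 => [|k]; last first.
      by rewrite -val_eqE /= => kn; rewrite mxE (negPf kn) /= mulr0.
    by rewrite mulVf // ie addn1 np eqxx.
  have jn' : (j < n)%N by lia.
  rewrite (bigD1 (Ordinal jn')) //=; last by rewrite -val_eqE /=; lia.
  have hj : (j < n.-1)%N by move: jn; rewrite -{1}np ltnS.
  rewrite mxE /= ifF; last exact: ltn_eqF.
  rewrite eqxx mulr1 mulrC addrA subrr add0r big1 => [|k /andP []]; last first.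
    rewrite -!val_eqE /= => kn kj; rewrite mxE (negPf kn) /=.
    by rewrite eqSS (negPf kj) mulr0.
  by rewrite [(_ == n)%N](_ : _ = false) //; apply/eqP; lia.
have hi := ltn_ord i.
have lt : (n - i.+2 < n)%N by lia.
rewrite (bigD1 (Ordinal lt)) //= CqP (negPf ie) big1 ?addr0 => [|k]; last first.
  rewrite -val_eqE /= => kn; rewrite CqP (negPf ie) [(_ == n)%N](_ : _ = false) ?mul0r //.
  by move: kn; lia.
rewrite [(_ == n)%N](_ : _ = true) ?mul1r; last by apply/eqP => /=; move: ie; lia.
have hi2 : (i.+1 < n)%N.
  have le_pred (x y z : nat) : (y = z -> x < y -> x != z.-1 -> x.+1 < z)%N by lia.
  exact: le_pred mE hi ie.
have lt_pred (x y : nat) : (x.+1 < y -> y - x.+2 < y.-1)%N by lia.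
rewrite mxE /= ifF; last exact: ltn_eqF (lt_pred _ _ hi2).
have nat_eq (x y z : nat) : (x.+1 < z)%N -> ((z - x.+2).+1 == y) = (x + y.+1 == z)%N by lia.
by rewrite nat_eq.
Qed.

End Reciprocal.

(** * Inverting matrices of square one, with control of the determinant *)

Section Inversion.

Variable F : finFieldType.
Implicit Types (p q : {poly F}) (s t : seq ({poly F} * nat)).

(* [A] is similar to the inverse of [B]. *)
Definition hsim_inv m n (A : 'M[F]_m) (B : 'M[F]_n) : Prop :=
  exists P : 'M[F]_(m, n), exists Q : 'M[F]_(n, m),
    [/\ P *m Q = 1%:M, Q *m P = 1%:M & A *m P *m B = P].

Lemma hsim_inv_unique l m n (A : 'M[F]_l) (B : 'M[F]_m) (C : 'M[F]_n) :
  hsim_inv A C -> hsim_inv B C -> hsim A B.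
Proof.
case=> P [P' [PP' P'P APC]] [R [R' [RR' R'R BRC]]]; exists (P *m R'), (R *m P').
split; first by rewrite mulmxA -(mulmxA P) R'R mulmx1.
  by rewrite mulmxA -(mulmxA R) P'P mulmx1.
have : (R' *m B *m R) *m C = 1%:M by rewrite -!mulmxA (mulmxA B) BRC.
move/mulmx1C => CB.
rewrite (mulmxA A) -[A *m P]mulmx1 -CB (mulmxA (A *m P)) APC -!mulmxA.
by rewrite RR' mulmx1.
Qed.

Lemma hsim_inv_trans k l m n (A : 'M[F]_k) (A' : 'M[F]_l) (B : 'M[F]_m) (B' : 'M[F]_n) :
  hsim A A' -> hsim B B' -> hsim_inv A B -> hsim_inv A' B'.
Proof.
move=> /hsim_sym [S [S' [SS' S'S SA]]] [R [R' [RR' R'R RB]]] [P [P' [PP' P'P APB]]].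
exists (S *m P *m R), (R' *m P' *m S'); split.
- rewrite !mulmxA -(mulmxA _ R R') RR' mulmx1 -(mulmxA _ P P') PP' mulmx1 //.
- rewrite !mulmxA -(mulmxA _ S' S) S'S mulmx1 -(mulmxA _ P' P) P'P mulmx1 //.
- by rewrite !mulmxA -SA -(mulmxA _ R) RB mulmxA -(mulmxA S A) -(mulmxA S (A *m P)) APB.
Qed.

Lemma hsim_inv_block k l m n (A : 'M[F]_k) (A' : 'M[F]_l) (B : 'M[F]_m) (B' : 'M[F]_n) :
  hsim_inv A B -> hsim_inv A' B' -> hsim_inv (block_mx A 0 0 A') (block_mx B 0 0 B').
Proof.
case=> P [P' [PP' P'P APB]] [R [R' [RR' R'R ARB]]].
exists (block_mx P 0 0 R), (block_mx P' 0 0 R').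
rewrite !mulmx_block !(mul0mx, mulmx0, addr0, add0r).
by rewrite PP' P'P RR' R'R APB ARB -!scalar_mx_block.
Qed.

Lemma hsim_inv_companion p : mpoly0 p -> hsim_inv (companionmx (recip p)) (companionmx p).
Proof.
move=> hp; have sE : (size (recip p)).-1 = (size p).-1 by rewrite size_recip.
exists (revmx F _ _), (revmx F _ _); rewrite !revmxK //; split=> //.
exact: companion_recip.
Qed.

Definition recip_type s := [seq (recip x.1, x.2) | x <- s].

Definition nonzero_type s := all (fun x : {poly F} * nat => mpoly0 x.1) s.

Lemma hsim_inv_type s : nonzero_type s ->
  hsim_inv (bdiag (elementary_divisors (recip_type s))) (bdiag (elementary_divisors s)).
Proof.
elim: s => [_|x s IH /= /andP [hx /IH {}IH]].
  by exists 1%:M, 1%:M; rewrite !mulmx1; split=> //; apply/matrixP; case.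
by apply: hsim_inv_block => //; rewrite -recipX //; apply: hsim_inv_companion; apply: mpoly0X.
Qed.

Lemma primary_recip_type s : nonzero_type s -> primary_type s -> primary_type (recip_type s).
Proof.
move=> /allP hs Hs x /mapP [y ys ->] /=; case: (Hs y ys) => irr y2; split=> //.
exact: recip_monic_irreducible (hs y ys) irr.
Qed.

Lemma mpoly0_type_poly s i : nonzero_type s -> mpoly0 (type_poly s i).
Proof.
elim: s => [_|x s IH /= /andP [hx /IH {}IH]]; first by rewrite /type_poly big_nil mpoly0_1.
by rewrite type_poly_cons mpoly0M //; case: eqP => // _; apply: mpoly0_1.
Qed.

Lemma type_poly_recip s i : nonzero_type s ->
  type_poly (recip_type s) i = recip (type_poly s i).
Proof.
elim: s => [_|x s IH /= /andP [hx hs]]; first by rewrite /type_poly !big_nil recip1.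
rewrite !type_poly_cons IH //= recipM ?mpoly0_type_poly //; last first.
  by case: eqP => // _; apply: mpoly0_1.
by case: eqP => // _; rewrite recip1.
Qed.

(** [recip_type s] is a type of the inverse of [g], so similarity to the inverse becomes equality of
    multisets of elementary divisors. *)
Lemma self_inverse_type n (g : 'M[F]_n) s : primary_type s -> nonzero_type s ->
  hsim g (bdiag (elementary_divisors s)) ->
  hsim_inv g g <-> perm_eq (recip_type s) s.
Proof.
move=> Hs hs sim; have rs := hsim_inv_type hs; split=> [gg|per].
  apply: hsim_perm => //; first exact: primary_recip_type.
  apply: hsim_trans (sim); apply: hsim_inv_unique gg.
  exact: hsim_inv_trans (hsim_refl _) (hsim_sym sim) rs.
apply: hsim_inv_trans (hsim_sym sim) rs; apply: hsim_trans (hsim_sym sim).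
by apply: bdiag_perm; apply: perm_map.
Qed.

Lemma self_recip_type s : primary_type s -> nonzero_type s ->
  perm_eq (recip_type s) s <-> (forall i, recip (type_poly s i) = type_poly s i).
Proof.
move=> Hs hs; split=> [per i|e]; first by rewrite -type_poly_recip //; apply: type_poly_perm.
apply: type_poly_inj => // [|i]; first exact: primary_recip_type.
by rewrite type_poly_recip.
Qed.

(** Since [h] has square one, [g *m h *m g = h] says that conjugation by [h] inverts [g], without
    writing an inverse. *)
Definition inverted n (g : 'M[F]_n) (x : F) :=
  exists h : 'M[F]_n, [/\ h *m h = 1%:M, g *m h *m g = h & \det h = x].

(** An invariant stable under direct sums: either both signs are available as determinants, or the
    size is twice some [m] and the sign (-1)^m is. A summand of the first kind makes the sum of the
    first kind, while in the second kind the exponents [m] add up along with the sizes. *)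
Definition balanced n (g : 'M[F]_n) :=
  (inverted g 1 /\ inverted g (-1)) \/
  (exists m, n = (m + m)%N /\ inverted g ((-1) ^+ m)).

Lemma inverted_hsim m n (A : 'M[F]_m) (B : 'M[F]_n) x :
  hsim A B -> inverted A x -> inverted B x.
Proof.
move=> AB [h [hh AhA dh]]; have [P [Q [PQ QP PB]]] := AB.
exists (Q *m h *m P); split.
- by rewrite !mulmxA -(mulmxA _ P Q) PQ mulmx1 -(mulmxA Q) hh mulmx1.
- have BQ : B *m Q = Q *m A.
    by rewrite -[B]mul1mx -QP -(mulmxA Q) PB -!mulmxA PQ mulmx1.
  by rewrite !mulmxA BQ -!(mulmxA Q) -(mulmxA _ P) PB !mulmxA -!(mulmxA Q) AhA.
- rewrite -dh; apply: hsim_det; exists Q, P; split=> //.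
  by rewrite -mulmxA PQ mulmx1.
Qed.

Lemma balanced_hsim m n (A : 'M[F]_m) (B : 'M[F]_n) :
  hsim A B -> balanced A -> balanced B.
Proof.
move=> AB; have e := hsim_size AB; case.
  by case=> h1 h2; left; split; apply: inverted_hsim AB _.
case=> k [mk inv]; right; exists k; split; first by rewrite -e.
exact: inverted_hsim AB inv.
Qed.

Lemma inverted_block m n (A : 'M[F]_m) (B : 'M[F]_n) x y :
  inverted A x -> inverted B y -> inverted (block_mx A 0 0 B) (x * y).
Proof.
case=> h [hh AhA dh] [k [kk BkB dk]]; exists (block_mx h 0 0 k).
rewrite !mulmx_block !(mul0mx, mulmx0, addr0, add0r) hh kk AhA BkB det_ublock dh dk.
by rewrite -scalar_mx_block.
Qed.

Lemma balanced_block m n (A : 'M[F]_m) (B : 'M[F]_n) :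
  balanced A -> balanced B -> balanced (block_mx A 0 0 B).
Proof.
case=> [[A1 A2]|[k [mk Ak]]]; case=> [[B1 B2]|[l [nl Bl]]].
- left; split; first by rewrite -[1]mulr1; apply: inverted_block.
  by rewrite -[-1]mulr1; apply: inverted_block.
- left; move: Bl; rewrite -signr_odd; case: (odd l) => Bl.
    split; last by rewrite -[-1]mul1r; apply: inverted_block.
    by rewrite -[1]mulr1 -mulrNN; apply: inverted_block.
  split; first by rewrite -[1]mulr1; apply: inverted_block.
  by rewrite -[-1]mulr1; apply: inverted_block.
- left; move: Ak; rewrite -signr_odd; case: (odd k) => Ak.
    split; last by rewrite -[-1]mulr1; apply: inverted_block.
    by rewrite -[1]mulr1 -mulrNN; apply: inverted_block.
  split; first by rewrite -[1]mulr1; apply: inverted_block.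
  by rewrite -[-1]mul1r; apply: inverted_block.
- right; exists (k + l)%N; split; first by rewrite mk nl addnACA.
  by rewrite exprD; apply: inverted_block.
Qed.

Lemma det_antidiag_block m (A B : 'M[F]_m) : A *m B = 1%:M ->
  \det (block_mx 0 A B 0 : 'M_(m + m)) = (-1) ^+ m.
Proof.
move=> AB; pose U : 'M[F]_(m + m) := block_mx 1%:M 1%:M 0 1%:M.
pose L : 'M[F]_(m + m) := block_mx 1%:M 0 (-1)%:M 1%:M.
pose D : 'M[F]_(m + m) := block_mx (-1)%:M 0 0 1%:M.
pose simp := (mul0mx, mulmx0, mul1mx, mulmx1, addr0, add0r).
(* The block matrix with rows (0, 1) and (-1, 0) is the product [U *m L *m U] of unipotent matrices
   and has determinant 1. Only the sign correction [D] contributes, by (-1)^m. *)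
have UL : U *m L = block_mx 0 1%:M (-1)%:M 1%:M.
  by rewrite mulmx_block !simp -raddfD /= subrr raddf0.
have ULU : U *m L *m U = block_mx 0 1%:M (-1)%:M 0.
  by rewrite UL mulmx_block !simp -raddfD /= addNr raddf0.
have -> : block_mx 0 A B 0 = block_mx A 0 0 B *m (U *m L *m U *m D).
  by rewrite ULU !mulmx_block !simp -scalar_mxM mulrNN mulr1 !mulmx1.
rewrite !det_mulmx det_ublock -det_mulmx AB det1 mul1r.
rewrite !det_ublock det_lblock !det1 !mulr1 !mul1r det_scalar.
by [].
Qed.

Lemma balanced_pair m n (A : 'M[F]_m) (B : 'M[F]_n) (P : 'M[F]_(m, n)) (Q : 'M[F]_(n, m)) :
  P *m Q = 1%:M -> Q *m P = 1%:M -> A *m P *m B = P -> B *m Q *m A = Q ->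
  balanced (block_mx A 0 0 B).
Proof.
move=> PQ QP APB BQA; have mn : m = n.
  by apply: (@hsim_size _ _ _ (0 : 'M[F]_m) (0 : 'M_n)); exists P, Q; rewrite mulmx0 mul0mx.
subst n; right; exists m; split=> //; exists (block_mx 0 P Q 0); split.
- by rewrite mulmx_block !(mul0mx, mulmx0, addr0, add0r) PQ QP -scalar_mx_block.
- by rewrite !mulmx_block !(mul0mx, mulmx0, addr0, add0r) APB BQA.
- exact: det_antidiag_block.
Qed.

Lemma det_revmx m : \det (revmx F (m + m) (m + m)) = (-1) ^+ m.
Proof.
rewrite -(@det_antidiag_block m (revmx F m m) (revmx F m m)) ?revmxK //.
congr (\det _); apply/matrixP => i j.
case: (split_ordP i) => k ->; case: (split_ordP j) => l ->;
  rewrite ?block_mxEul ?block_mxEur ?block_mxEdl ?block_mxEdr !mxE /=;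
  have hk := ltn_ord k; have hl := ltn_ord l.
- by rewrite [(_ == _)](_ : _ = false) //; move: (nat_of_ord k) (nat_of_ord l) hk hl => x y; lia.
- by congr ((nat_of_bool _)%:R); move: (nat_of_ord k) (nat_of_ord l) hk hl => x y; lia.
- by congr ((nat_of_bool _)%:R); move: (nat_of_ord k) (nat_of_ord l) hk hl => x y; lia.
- by rewrite [(_ == _)](_ : _ = false) //; move: (nat_of_ord k) (nat_of_ord l) hk hl => x y; lia.
Qed.

(** In odd size the reversal and its opposite both invert [C] and have opposite determinants; in
    even size the reversal has determinant (-1)^(n/2). *)
Lemma balanced_revmx n (C : 'M[F]_n) :
  C *m revmx F n n *m C = revmx F n n -> balanced C.
Proof.
have [odd_n|even_n] := boolP (odd n); last first.
  have [m nE] : exists m, n = (m + m)%N.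
    by exists n./2; rewrite addnn -[LHS]odd_double_half (negPf even_n).
  subst n => CJC; right; exists m; split=> //; exists (revmx F _ _); split=> //.
    exact: revmxK.
  exact: det_revmx.
set J := revmx F n n => CJC; have JJ : J *m J = 1%:M by apply: revmxK.
left; have : \det J ^+ 2 == 1 by rewrite expr2 -det_mulmx JJ det1.
have inv1 : inverted C (\det J) by exists J.
have inv2 : inverted C (- \det J).
  exists (- J); rewrite !mulmxN !mulNmx opprK JJ CJC; split=> //.
  by rewrite -scaleN1r detZ -signr_odd odd_n mulN1r.
by rewrite sqrf_eq1 => /orP [] /eqP dJ; move: inv1 inv2; rewrite dJ ?opprK.
Qed.

(** A block with self-reciprocal [x.1] is inverted by the reversal. Any other block occurs together
    with its reciprocal, and the swap of the two blocks inverts their sum; removing both leaves a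
    list still closed under reciprocals. *)
Lemma balanced_type s : primary_type s -> nonzero_type s ->
  perm_eq (recip_type s) s -> balanced (bdiag (elementary_divisors s)).
Proof.
have [n] := ubnP (size s); elim: n s => // n IH [|x s] sn Hs hs per.
  right; exists 0%N; split=> //; exists 0.
  by split; rewrite ?det_mx00 //; apply/matrixP; case.
have [[irr x2] Hs'] := (primary_type_cons x s).1 Hs.
have /= /andP [hx hs'] := hs; have hxn := mpoly0X x.2 hx.
have [xx|nx] := eqVneq (recip x.1) x.1.
  apply: balanced_block.
    by apply: balanced_revmx; have := companion_recip hxn; rewrite recipX // xx.
  apply: IH => //; move: per; rewrite /= xx -surjective_pairing perm_cons.
  by [].
pose y := (recip x.1, x.2).
have ys : y \in s.
  have : y \in x :: s by rewrite -(perm_mem per) mem_head.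
  by rewrite inE => /predU1P [e|//]; case/eqP: nx; have := congr1 fst e.
have sy := perm_to_rem ys; set t := rem y s in sy.
have hy : mpoly0 y.1 := recip_mpoly0 hx.
have hyx : recip y.1 = x.1 by rewrite recipK.
have [_ Ht] := (primary_type_cons _ _).1 (primary_type_perm sy Hs').
have ht : nonzero_type t.
  by move: hs'; rewrite /nonzero_type (perm_all _ sy) /= => /andP [].
have sim : hsim (block_mx (block_mx (companionmx (x.1 ^+ x.2)) 0 0 (companionmx (y.1 ^+ y.2))) 0 0
     (bdiag (elementary_divisors t))) (bdiag (elementary_divisors (x :: s))).
  apply: hsim_trans (hsim_sym (hsim_assoc _ _ _)) _; apply: hsim_block (hsim_refl _) _.
  by apply: (bdiag_perm (s := elementary_divisors (y :: t))); apply: perm_map; rewrite perm_sym.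
apply: balanced_hsim sim _; apply: balanced_block; last first.
  apply: IH => //.
    by have := perm_size sy; move: sn => /=; move: (size s) (size t) => a b; lia.
  have rsy : perm_eq (recip_type s) (x :: recip_type t).
    by have := perm_map (fun x => (recip x.1, x.2)) sy; rewrite /= hyx -surjective_pairing.
  suff : perm_eq [:: y, x & recip_type t] [:: y, x & t] by rewrite !perm_cons.
  apply: (@perm_trans _ (y :: recip_type s)); first by rewrite perm_cons perm_sym.
  apply: perm_trans per _; apply: (@perm_trans _ [:: x, y & t]); first by rewrite perm_cons.
  exact: permEl (perm_catCA [:: x] [:: y] t).
have e1 := companion_recip hxn; have e2 := companion_recip (mpoly0X y.2 hy).
rewrite recipX //= in e1; rewrite recipX //= hyx in e2.
apply: (balanced_pair (P := revmx F _ _) (Q := revmx F _ _) _ _ e2 e1); apply: revmxK;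
  by rewrite !size_exp size_recip.
Qed.

End Inversion.

(** * Determinants on stable subspaces and the socle filtration *)

Section RestrictedDeterminant.

Variable F : fieldType.

(* The determinant of the restriction of [z] to the row space of [U], when [z]
   stabilises it. *)
Definition rdet m n (U : 'M[F]_(m, n)) (z : 'M[F]_n) : F :=
  \det (row_base U *m z *m pinvmx (row_base U)).

Lemma rdetP m n k (U : 'M[F]_(m, n)) (z : 'M[F]_n) (B : 'M[F]_(k, n)) (A : 'M[F]_k) :
  (B :=: U)%MS -> row_free B -> B *m z = A *m B -> rdet U z = \det A.
Proof.
move=> BU Bfree Bz; rewrite /rdet; set R := row_base U.
have RB : (R :=: B)%MS by apply: eqmx_trans (eq_row_base U) (eqmx_sym BU).
have /submxP [P RE] : (R <= B)%MS by rewrite RB.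
have /submxP [Q BE] : (B <= R)%MS by rewrite RB.
have PQ : P *m Q = 1%:M.
  by apply: (row_free_inj (row_base_free U)); rewrite -mulmxA -BE -RE mul1mx.
have QP : Q *m P = 1%:M.
  by apply: (row_free_inj Bfree); rewrite -mulmxA -RE -BE mul1mx.
apply: hsim_det; exists P, Q; split=> //.
apply: (row_free_inj Bfree).
rewrite -mulmxA -Bz mulmxA -RE -[RHS]mulmxA -RE mulmxKpV //.
by rewrite {1}RE -mulmxA Bz mulmxA RB submxMl.
Qed.

Lemma rdet_eqmx m m' n (U : 'M[F]_(m, n)) (V : 'M[F]_(m', n)) (z : 'M[F]_n) :
  (U :=: V)%MS -> stablemx V z -> rdet U z = rdet V z.
Proof.
move=> UV Vz; apply: (@rdetP _ _ _ _ _ (row_base V)).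
- exact: eqmx_trans (eq_row_base V) (eqmx_sym UV).
- exact: row_base_free.
- by rewrite mulmxKpV // eq_row_base (eqmxMr _ (eq_row_base V)).
Qed.

Lemma rdet_full n (z : 'M[F]_n) : rdet (1%:M : 'M[F]_n) z = \det z.
Proof.
by apply: (@rdetP _ _ _ _ _ 1%:M); rewrite ?mulmx1 ?mul1mx // row_free_unit unitmx1.
Qed.

Lemma rdet0 m n (U : 'M[F]_(m, n)) (z : 'M[F]_n) : U = 0 -> rdet U z = 1.
Proof.
move=> ->; rewrite (@rdetP _ _ 0 _ _ 0 0) ?det_mx00 //.
- by apply/eqmxP; rewrite !sub0mx.
- by rewrite /row_free mxrank0.
- by rewrite mul0mx mulmx0.
Qed.

(** [rho] induces an isomorphism, compatible with [z], from the quotient of [W] by its intersection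
    with the kernel onto [W *m rho]. In a basis made of a basis of that intersection and of lifts
    [C] of a basis of the image, [z] is block triangular. *)
Lemma rdet_ker_im m n (W : 'M[F]_(m, n)) (z rho : 'M[F]_n) :
  stablemx W z -> rho *m z = z *m rho ->
  rdet W z = rdet (W :&: kermx rho)%MS z * rdet (W *m rho) z.
Proof.
move=> Wz rz; set K := row_base (W :&: kermx rho)%MS; set R := row_base (W *m rho).
have Kst : stablemx (W :&: kermx rho)%MS z.
  rewrite sub_capmx (submx_trans (submxMr _ (capmxSl _ _)) Wz) /=.
  apply/sub_kermxP; rewrite -mulmxA -rz mulmxA.
  by rewrite (sub_kermxP (capmxSr _ _)) mul0mx.
have Rst : stablemx (W *m rho) z by rewrite -mulmxA rz mulmxA submxMr.
have K_eq : (K :=: (W :&: kermx rho))%MS := eq_row_base _.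
have R_eq : (R :=: W *m rho)%MS := eq_row_base _.
have /submxP [C' RE] : (R <= W *m rho)%MS by rewrite R_eq.
set C := C' *m W; have CR : C *m rho = R by rewrite /C -mulmxA -RE.
have Krho : K *m rho = 0 by apply/sub_kermxP; rewrite K_eq capmxSr.
pose T := col_mx K C.
have Tfree : row_free T.
  rewrite -kermx_eq0; apply/eqP/row_matrixP => i; rewrite row0.
  set u := row i _; have : u *m T = 0 by rewrite /u -row_mul mulmx_ker row0.
  rewrite -[u]hsubmxK mul_row_col => uT.
  have u2 : rsubmx u = 0.
    apply: (row_free_inj (row_base_free (W *m rho))); rewrite mul0mx -/R -CR.
    have := congr1 (mulmx^~ rho) uT; rewrite mulmxDl -(mulmxA _ K) -(mulmxA _ C) Krho mulmx0 add0r mul0mx.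
    by [].
  have u1 : lsubmx u = 0.
    apply: (row_free_inj (row_base_free (W :&: kermx rho)%MS)); rewrite mul0mx -/K.
    by rewrite -[RHS]uT u2 mul0mx addr0.
  by rewrite u1 u2 row_mx0.
have TW : (T <= W)%MS by rewrite col_mx_sub submxMl K_eq capmxSl.
have T_eq : (T :=: W)%MS.
  apply/eqmxP; rewrite -(geq_leqif (mxrank_leqif_eq TW)) (eqP Tfree).
  by rewrite addnC mxrank_mul_ker.
have /submxP [A1 KE] : (K *m z <= K)%MS by rewrite (eqmxMr z K_eq) K_eq.
have /submxP [A2 RE2] : (R *m z <= R)%MS by rewrite (eqmxMr z R_eq) R_eq.
have /submxP [X CE] : (C *m z <= T)%MS.
  by rewrite T_eq (submx_trans _ Wz) // submxMr // submxMl.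
rewrite (rdetP K_eq (row_base_free _) KE) (rdetP R_eq (row_base_free _) RE2).
rewrite -[X]hsubmxK mul_row_col in CE.
have XA : rsubmx X = A2.
  apply: (row_free_inj (row_base_free (W *m rho))); rewrite -/R -RE2 -CR.
  have := congr1 (mulmx^~ rho) CE; rewrite mulmxDl -(mulmxA _ K) -[_ *m C *m rho](mulmxA _ C) Krho mulmx0 add0r.
  by rewrite -(mulmxA C) -rz mulmxA => ->.
rewrite -(det_lblock A1 (lsubmx X)); apply: (rdetP T_eq Tfree).
by rewrite /T mul_block_col mul0mx addr0 mul_col_mx KE CE XA.
Qed.

(** [f] can change value only at multiples of [h], so it is constant on each of the [M] consecutive
    blocks of length [h]. *)
Lemma prod_periodic (h M : nat) (f : nat -> F) : (0 < h)%N ->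
  (forall k, ~~ (h %| k.+1)%N -> f k.+1 = f k) ->
  \prod_(k < h * M) f k = (\prod_(m < M) f (h * m)%N) ^+ h.
Proof.
move=> h0 fE; have fE' m j : (j < h)%N -> f (h * m + j)%N = f (h * m)%N.
  elim: j => [|j IH] jh; first by rewrite addn0.
  rewrite addnS fE ?IH ?(ltnW jh) // -addnS dvdn_addr ?dvdn_mulr //.
  by rewrite gtnNdvd.
elim: M => [|M IH]; first by rewrite muln0 !big_ord0 expr1n.
rewrite [in RHS]big_ord_recr /= exprMn -IH mulnS addnC big_split_ord /=; congr (_ * _).
rewrite (eq_bigr (fun=> f (h * M)%N)) => [|j _]; last exact: fE'.
by rewrite prodr_const card_ord.
Qed.

Section SocleFiltration.

Variables (n : nat) (g z : 'M[F]_n) (r : {poly F}).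
Hypothesis gz : g *m z = z *m g.

Let image k := hornermx g (r ^+ k).
Let socle k := (image k :&: kermx (hornermx g r))%MS.

Lemma hornermx_commute p : hornermx g p *m z = z *m hornermx g p.
Proof. by rewrite (hornermx_intertwine p (esym gz)). Qed.

Let image_stable k : stablemx (image k) z.
Proof. by rewrite /image hornermx_commute submxMl. Qed.

Let imageS k : image k.+1 = image k *m hornermx g r.
Proof. by rewrite /image exprSr hornermxM. Qed.

Let socle_stable k : stablemx (socle k) z.
Proof.
rewrite sub_capmx (submx_trans (submxMr _ (capmxSl _ _)) (image_stable k)) /=.
apply/sub_kermxP; rewrite -mulmxA -hornermx_commute mulmxA.
by rewrite (sub_kermxP (capmxSr _ _)) mul0mx.
Qed.

(** [rdet_ker_im] for multiplication by [r] peels one socle off the image of each power of [r],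
    until the image vanishes. *)
Lemma det_socle_filtration N : hornermx g (r ^+ N) = 0 ->
  \det z = \prod_(k < N) rdet (image k :&: kermx (hornermx g r))%MS z.
Proof.
move=> rN; have step M : \det z = \prod_(k < M) rdet (socle k) z * rdet (image M) z.
  elim: M => [|M IH].
    by rewrite big_ord0 mul1r -rdet_full /image expr0 hornermx1.
  rewrite IH big_ord_recr /= -mulrA; congr (_ * _).
  by rewrite imageS; apply: rdet_ker_im (image_stable M) (hornermx_commute r).
by rewrite (step N) (rdet0 _ rN) mulr1.
Qed.

Lemma det_commutant_power h M : (0 < h)%N -> hornermx g (r ^+ (h * M)) = 0 ->
  (forall k, ~~ (h %| k.+1)%N ->
    (\rank (image k) + \rank (image k.+2) = \rank (image k.+1) + \rank (image k.+1))%N) ->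
  \det z = (\prod_(m < M) rdet (hornermx g (r ^+ (h * m)) :&: kermx (hornermx g r))%MS z) ^+ h.
Proof.
move=> h0 rN rankE; rewrite (det_socle_filtration rN).
rewrite (@prod_periodic h M (fun k => rdet (socle k) z)) // => k hk.
(* The dimension of [socle k] is the drop of rank from [image k] to [image k.+1]. The rank
   hypothesis equates two successive drops, so the inclusion of socles is an equality. *)
apply: rdet_eqmx (socle_stable k); apply/eqmxP.
have sub : (socle k.+1 <= socle k)%MS.
  rewrite capmxS // imageS /image -hornermxM mulrC hornermxM.
  exact: submxMl.
rewrite -(geq_leqif (mxrank_leqif_eq sub)).
have := rankE k hk; have := mxrank_mul_ker (image k) (hornermx g r).
have := mxrank_mul_ker (image k.+1) (hornermx g r); rewrite -!imageS -/(socle _) -/(socle _).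
move: (\rank (image _)) (\rank (image _)) (\rank (image _)) => a b c.
by move: (\rank _) (\rank _) => d e; lia.
Qed.

End SocleFiltration.

End RestrictedDeterminant.

(** * Determinants of commuting matrices are h-th powers *)

Section CommutantDeterminant.

Variable F : finFieldType.
Implicit Types (p q a b c d phi : {poly F}) (s t : seq ({poly F} * nat)).

Lemma hsim_commutant m n (A : 'M[F]_m) (B : 'M[F]_n) (z : 'M[F]_m) :
  hsim A B -> A *m z = z *m A ->
  exists w : 'M[F]_n, B *m w = w *m B /\ \det w = \det z.
Proof.
move=> /[dup] AB [P [Q [PQ QP PB]]] Az; exists (Q *m z *m P).
have BQ : B *m Q = Q *m A by rewrite -[B]mul1mx -QP -(mulmxA Q) PB -!mulmxA PQ mulmx1.
split; first by rewrite !mulmxA BQ -(mulmxA _ P) PB !mulmxA -(mulmxA Q A) Az mulmxA.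
by apply: hsim_det; exists Q, P; split=> //; rewrite -mulmxA PQ mulmx1.
Qed.

Definition type_radical s : {poly F} := \prod_(phi <- undup [seq x.1 | x <- s]) phi.

Lemma type_radicalE s x : primary_type s -> x \in s ->
  exists r, coprimep x.1 r /\ type_radical s = x.1 * r.
Proof.
move=> Hs xs; have x1 : x.1 \in undup [seq x.1 | x <- s] by rewrite mem_undup map_f.
exists (\prod_(phi <- undup [seq x.1 | x <- s] | phi != x.1) phi); split.
  rewrite big_seq_cond; apply: (big_ind (fun r => coprimep x.1 r)).
  - exact: coprimep1.
  - by move=> u v cu cv; rewrite coprimepMr cu.
  move=> phi /andP []; rewrite mem_undup => /mapP [y ys ->] yx.
  rewrite coprimep_sym; case: (Hs y ys) => irry _; case: (Hs x xs) => irrx _.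
  exact: monic_irreducible_coprime.
by rewrite /type_radical (bigD1_seq x.1) ?undup_uniq.
Qed.

Lemma rank_radical s k : primary_type s ->
  \rank (hornermx (bdiag (elementary_divisors s)) (type_radical s ^+ k))
  = (\sum_(x <- s) (size x.1).-1 * (x.2 - k))%N.
Proof.
move=> Hs; rewrite rank_bdiag big_map; apply: eq_big_seq => x xs.
have [r [cop ->]] := type_radicalE Hs xs; rewrite exprMn rank_companion_primary //.
  by case: (Hs x xs).
exact: coprimep_expr.
Qed.

Lemma det_commutant_sub n (g z : 'M[F]_n) s h : primary_type s ->
  hsim g (bdiag (elementary_divisors s)) -> g *m z = z *m g -> (0 < h)%N ->
  (forall x, x \in s -> h %| x.2)%N ->
  exists y, \det z = y ^+ h.
Proof.
move=> Hs sim gz h0 hs.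
have rE k : \rank (hornermx g (type_radical s ^+ k)) = (\sum_(x <- s) (size x.1).-1 * (x.2 - k))%N.
  by rewrite -rank_radical //; apply: hsim_rank; apply: hsim_hornermx.
(* [M] only has to make [type_radical s ^+ (h * M)] vanish at [g]; the sum of the exponents bounds
   each of them. *)
eexists; apply: (det_commutant_power (r := type_radical s) (M := (\sum_(x <- s) x.2)%N) gz h0).
  apply/eqP; rewrite -mxrank_eq0 rE big_seq big1 // => x xs.
  apply/eqP; rewrite muln_eq0 subn_eq0 (leq_trans _ (leq_pmull _ h0)) ?orbT //.
  by rewrite (big_rem x) //= leq_addr.
move=> k hk; rewrite !rE -!big_split /=; apply: eq_big_seq => x xs.
rewrite -!mulnDr; congr (_ * _)%N.
have : x.2 != k.+1 by apply: contraNneq hk => <-; apply: hs.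
by move: (x.2) => j; lia.
Qed.

(** With a single exponent [i], all [i] socles in the filtration coincide with the kernel of [phi].
    That kernel is generated by the class of [phi ^+ i.-1], and there [C] acts as
    [companionmx phi]. *)
Lemma det_companion_power phi i a : monic_irreducible phi -> (0 < i)%N ->
  \det (hornermx (companionmx (phi ^+ i)) a) = \det (hornermx (companionmx phi) a) ^+ i.
Proof.
move=> irr i0; have [mphi irr'] := irr; set C := companionmx (phi ^+ i).
have mphii : phi ^+ i \is monic by apply: monic_exp.
have rE k : \rank (hornermx C (phi ^+ k)) = ((size phi).-1 * (i - k))%N.
  by rewrite -[phi ^+ k]mulr1 rank_companion_primary ?coprimep1.
have Ca : C *m hornermx C a = hornermx C a *m C.
  by rewrite -{1 4}(hornermxX C) hornermx_comm.
have -> := det_commutant_power (r := phi) (M := 1%N) Ca i0; last 2 first.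
- by rewrite muln1 companion_annihilated.
- move=> k ik; rewrite !rE -!mulnDr; congr (_ * _)%N.
  have : i != k.+1 by apply: contraNneq ik => ->.
  by lia.
rewrite big_ord1 muln0; congr (_ ^+ _).
pose v := poly_rV 1 *m hornermx C (phi ^+ i.-1).
have vphi : v *m hornermx C phi = 0.
  by rewrite /v -mulmxA -hornermxM -exprSr prednK // companion_annihilated // mulmx0.
have free : row_free (krylovmx (size phi).-1 C v).
  apply: krylovmx_free => // c; rewrite /v -mulmxA -hornermxM => /eqP.
  rewrite companion_coord_eq0 // -{1}(prednK i0) exprSr dvdp_mul2l //.
  by rewrite monic_neq0 ?monic_exp.
apply: (rdetP (B := krylovmx (size phi).-1 C v)) => //; last first.
  by rewrite (hornermx_intertwine _ (krylovmx_companion mphi vphi)).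
have sub : (krylovmx (size phi).-1 C v <= kermx (hornermx C phi))%MS.
  apply/sub_kermxP/row_matrixP => j; rewrite row_mul rowK row0.
  by rewrite -mulmxA hornermx_comm mulmxA vphi mul0mx.
have ker_eq : (hornermx C (phi ^+ 0) :&: kermx (hornermx C phi) :=: kermx (hornermx C phi))%MS.
  rewrite expr0 hornermx1; apply/eqmxP; rewrite capmxSr sub_capmx submx1 submx_refl.
  by [].
apply: eqmx_trans (eqmx_sym ker_eq); apply/eqmxP.
rewrite -(geq_leqif (mxrank_leqif_eq sub)) (eqP free) mxrank_ker.
rewrite -[phi in hornermx C phi]expr1 rE size_exp -mulnBr.
by have -> : (i - (i - 1) = 1)%N; [lia | rewrite muln1].
Qed.

End CommutantDeterminant.

(** * Surjectivity of the norm, and determinants attained by the commutant *)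

Section Norm.

Lemma finfield_generator (K : finFieldType) :
  exists2 a : K, a != 0 & forall m, a ^+ m = 1 -> (#|K|.-1 %| m)%N.
Proof.
have /cyclicP [x xE] := field_unit_group_cyclic [set: {unit K}]%G.
exists (val x); first by rewrite -unitfE (valP x).
move=> m; rewrite -FinRing.val_unitX => /eqP xm.
by rewrite -card_finField_unit xE order_dvdn -val_eqE.
Qed.

Lemma generator_powers (K : finFieldType) (a : K) : a != 0 ->
  (forall m, a ^+ m = 1 -> (#|K|.-1 %| m)%N) -> forall x, x != 0 -> exists m, x = a ^+ m.
Proof.
move=> a0 ord x x0; pose f (i : 'I_#|K|.-1) := a ^+ i.
have f_inj : injective f.
  have main (i j : 'I_#|K|.-1) : f i = f j -> (i <= j)%N -> i = j.
    rewrite /f => + ij; rewrite -(subnKC ij) exprD -[in LHS](mulr1 (a ^+ i)).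
    move/(mulfI (expf_neq0 _ a0)) => /esym /ord /dvdn_leq.
    move=> le; apply: val_inj => /=; have := ltn_ord j; move: ij le.
    have key (u v w : nat) : (u <= v -> (0 < v - u -> w <= v - u) -> v < w -> u = v)%N by lia.
    exact: key.
  move=> i j fij; case: (leqP i j) => [|/ltnW] ij; first exact: main.
  by apply/esym/main.
have : f @: [set: 'I_#|K|.-1] == [set~ 0].
  rewrite eqEcard card_imset // cardsT card_ord cardsC1 leqnn andbT.
  by apply/subsetP => y /imsetP [i _ ->]; rewrite !inE expf_neq0.
move/eqP/setP/(_ x); rewrite !inE x0 => /imsetP [i _ ->]; by exists i.
Qed.

Lemma finfield_Frobenius (F K : finFieldType) (f : {rmorphism F -> K}) (p : {poly F}) (a : K) :
  (map_poly f p).[a ^+ #|F|] = (map_poly f p).[a] ^+ #|F|.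
Proof.
have [l pr_l charF] := finPcharP F.
have charK : [pchar K].-nat #|F|.
  rewrite (eq_pnat _ (pcharf_eq (rmorph_pchar f charF))) -cardsT.
  exact: abelem_pgroup (fin_ring_pchar_abelem charF).
elim/poly_ind: p => [|p c IH]; first by rewrite rmorph0 !horner0 expr0n gtn_eqF // ltnW // finNzRing_gt1.
rewrite rmorphD rmorphM /= map_polyX map_polyC !hornerE /= IH.
rewrite exprDn_pchar // exprMn -rmorphXn /= expf_card.
by [].
Qed.

(** The powers [a ^+ (q ^ k)] for [k < d] are roots of [p] by Frobenius. They are distinct, since
    two equal ones would give the generator an order below [#|K|.-1]. Hence they are all the roots,
    and the signed constant term is their product. *)
Lemma norm_of_generator (F K : finFieldType) (f : {rmorphism F -> K}) (p : {poly F}) (a : K) d :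
  #|K| = (#|F| ^ d)%N -> a != 0 -> (forall m, a ^+ m = 1 -> (#|K|.-1 %| m)%N) ->
  p \is monic -> size p = d.+1 -> root (map_poly f p) a ->
  f ((-1) ^+ d * p`_0) = a ^+ (\sum_(k < d) #|F| ^ k).
Proof.
move=> cK a0 ord mp sp pa; set q := #|F| in cK *.
have q1 : (1 < q)%N := finNzRing_gt1 F.
have paq k : root (map_poly f p) (a ^+ (q ^ k)).
  elim: k => [|k IH]; first by rewrite expn0 expr1.
  by rewrite expnSr exprM /root finfield_Frobenius (rootP IH) expr0n gtn_eqF // ltnW.
pose rs := mkseq (fun k => a ^+ (q ^ k)) d.
have sumq : ((q - 1) * \sum_(k < d) q ^ k = q ^ d - 1)%N.
  by rewrite !subn1 -predn_exp.
have cK1 : #|K|.-1 = (q ^ d - 1)%N by rewrite cK subn1.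
have rs_uniq : uniq rs.
  have main i j : (i < j < d)%N -> a ^+ (q ^ i) <> a ^+ (q ^ j).
    move=> /andP [ij jd] e; have qij : (q ^ i < q ^ j)%N by rewrite ltn_exp2l.
    have : a ^+ (q ^ j - q ^ i) = 1.
      apply: (mulfI (expf_neq0 (q ^ i) a0)).
      by rewrite -exprD subnKC ?(ltnW qij) // mulr1.
    move/ord; rewrite cK1 => /dvdn_leq.
    have : (0 < q ^ i)%N by rewrite expn_gt0 ltnW.
    have : (q ^ j < q ^ d)%N by rewrite ltn_exp2l.
    by move: qij; move: (q ^ i)%N (q ^ j)%N (q ^ d)%N => u v w; lia.
  apply/(uniqP 0) => i j; rewrite !inE size_mkseq => id jd.
  rewrite !nth_mkseq // => e; case: (ltngtP i j) => // lt.
    by case: (main i j); rewrite ?lt ?jd.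
  by case: (main j i); rewrite ?lt ?id.
have mfp : map_poly f p \is monic by apply: monic_map.
have pE : map_poly f p = \prod_(z <- rs) ('X - z%:P).
  rewrite (all_roots_prod_XsubC (p := map_poly f p) (rs := rs)).
  - by rewrite (monicP mfp) scale1r.
  - by rewrite size_map_poly sp size_mkseq.
  - by apply/allP => z /mapP [k _ ->].
  - by rewrite uniq_rootsE.
have := congr1 (fun r => r.[0]) pE.
rewrite horner_coef0 coef_map /= horner_prod big_map -[d in iota 0 d]subn0 big_mkord /=.
rewrite rmorphM rmorphXn rmorphN1 => ->.
under eq_bigr => k _ do rewrite !hornerE.
rewrite prodrN card_ord mulrA -signr_odd -signr_addb addbb mul1r.
by rewrite -[LHS]expr_sum.
Qed.
Lemma hornermx_comp (F : fieldType) n (g : 'M[F]_n) p q :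
  hornermx g (p \Po q) = hornermx (hornermx g q) p.
Proof.
elim/poly_ind: p => [|p c IH]; first by rewrite comp_poly0 !hornermx0.
rewrite comp_poly_MXaddC !hornermxD !hornermxC !hornermxM IH hornermxX.
by [].
Qed.

Lemma hornermx_char_poly (F : fieldType) n (g : 'M[F]_n) : hornermx g (char_poly g) = 0.
Proof. by case: n g => [|n] g; [rewrite [LHS]flatmx0 | apply: Cayley_Hamilton]. Qed.

(** The determinant of the polynomial representing a generator of K = F[X]/phi is its norm, a power
    with exponent [N], the quotient of [#|K|.-1] by [#|F|.-1]. It therefore has order [#|F|.-1], and
    its powers exhaust the nonzero scalars. *)
Lemma companion_det_surjective (F : finFieldType) (phi : {poly F}) (c : F) :
  monic_irreducible phi -> c != 0 ->
  exists a, \det (hornermx (companionmx phi) a) = c.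
Proof.
move=> [mphi irr] c0; have hI : monic_irreducible_poly phi by split.
pose K : finFieldType := {poly %/ phi with hI}.
pose f : {rmorphism F -> K} := qpolyC phi.
have cK : #|K| = (#|F| ^ (size phi).-1)%N by apply: card_qfpoly.
have [a0 a0_neq0 a0_ord] := finfield_generator K.
pose a : {poly F} := val (a0 : {poly %/ phi}).
set M := hornermx (companionmx phi) a; pose chi := char_poly M.
have in_a : in_qpoly phi a = a0.
  by apply: val_inj => /=; rewrite /a; apply: in_qpoly_small; apply: size_mk_monic.
(* Cayley-Hamilton for [M] says that [phi] divides [chi \Po a], which in the quotient field means
   that [chi] vanishes at [a0]. *)
have chi_root : root (map_poly f chi) a0.
  have chiM : hornermx (companionmx phi) (chi \Po a) = 0.
    by rewrite hornermx_comp hornermx_char_poly.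
  move/eqP: chiM; rewrite hornermx_companion_eq0 // => dvd.
  have : in_qpoly phi (chi \Po a) = 0.
    case/dvdpP: dvd => r ->; rewrite in_qpolyM.
    have -> : in_qpoly phi phi = 0 by apply: val_inj; rewrite /= mk_monicE // Pdiv.RingMonic.rmodpp.
    by rewrite mulr0.
  by rewrite in_qpoly_comp_horner in_a => e; apply/eqP.
have e := norm_of_generator cK a0_neq0 a0_ord (char_poly_monic M) (size_char_poly M) chi_root.
set N := (\sum_(_ < _) _)%N in e.
have detM : f (\det M) = a0 ^+ N.
  rewrite -e; congr (f _).
  by rewrite char_poly_det mulrA -signr_odd -signr_addb addbb mul1r.
have det0 : \det M != 0.
  by rewrite -(fmorph_eq0 f) detM expf_neq0.
have NE : (N * #|F|.-1)%N = #|K|.-1 by rewrite mulnC /N -predn_exp cK.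
have N0 : (0 < N)%N.
  by have := finNzRing_gt1 K; move: NE; case: (N) => //; rewrite mul0n; case: #|K| => [|[]].
have [m|m cE] := generator_powers det0 _ c0.
  move=> /(congr1 f); rewrite rmorphXn /= detM -exprM rmorph1 => /a0_ord.
  by rewrite -NE dvdn_pmul2l.
exists (a ^+ m); rewrite cE; elim: m {cE} => [|m IH].
  by rewrite !expr0 hornermx1 det1.
by rewrite !exprS hornermxM det_mulmx IH.
Qed.

Lemma commutant_det_surjective (F : finFieldType) n (g : 'M[F]_n) s x (c : F) :
  primary_type s -> hsim g (bdiag (elementary_divisors s)) -> x \in s -> c != 0 ->
  exists z : 'M[F]_n, g *m z = z *m g /\ \det z = c ^+ x.2.
Proof.
move=> Hs sim xs c0; have [irr x2] := Hs x xs.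
have [a aE] := companion_det_surjective irr c0.
have sim' : hsim g (bdiag (elementary_divisors (x :: rem x s))).
  by apply: hsim_trans (sim) _; apply: bdiag_perm; apply: perm_map; apply: perm_to_rem.
have [|z [gz dz]] := hsim_commutant (z := block_mx (hornermx (companionmx (x.1 ^+ x.2)) a) 0 0 1%:M) (hsim_sym sim').
  rewrite /= !mulmx_block !(mul0mx, mulmx0, mul1mx, mulmx1, addr0, add0r).
  by rewrite -{1 4}(hornermxX (companionmx (x.1 ^+ x.2))) hornermx_comm.
by exists z; rewrite dz det_ublock det1 mulr1 det_companion_power // aE.
Qed.

End Norm.

(** * Real classes of a finite group as a number of pairs *)

Section RealClassCount.

Import GroupScope.

Variable gT : finGroupType.
Implicit Type G : {group gT}.

Lemma real_eltJ G x y : x \in G -> real_elt G (y ^ x) = real_elt G y.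
Proof.
have sub z t : z \in G -> real_elt G t -> real_elt G (t ^ z).
  move=> Gz /exists_inP [h Gh /eqP ht]; apply/exists_inP; exists (h ^ z); first by rewrite groupJ.
  by rewrite -!conjVg -!conjMg ht.
move=> Gx; apply/idP/idP => [|]; last exact: sub.
by move/(sub x^-1); rewrite groupV conjgK; apply.
Qed.

Definition inverting_pairs G (y : gT) :=
  [set u in setX G G | u.2 * u.1 * u.2^-1 * u.1 == y].

(** The elements inverting [g] are either absent or form a coset of the centraliser. *)
Lemma card_inverting_with G g : g \in G ->
  #|[set h in G | h * g * h^-1 * g == 1]| = (if real_elt G g then #|'C_G[g]| else 0)%N.
Proof.
move=> Gg; case: ifPn => [/exists_inP [h0 Gh0 /eqP h0g]|nr].
  rewrite -(card_lcoset 'C_G[g] h0); apply: eq_card => h.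
  rewrite inE mem_lcoset in_setI groupMl ?groupV //; case Gh: (h \in G) => //=.
  apply/eqP/cent1P => [e|].
    have e' : h * g * h^-1 = h0 * g * h0^-1 by rewrite h0g -[LHS](mulgK g) e mul1g.
    rewrite /commute -(mulgA h0^-1) -[h * g](mulgKV h) e'.
    by rewrite !mulgA mulVg mul1g.
  rewrite /commute => c; have -> : h * g * h^-1 = h0 * g * h0^-1.
    have := congr1 (fun x => h0 * x * h^-1) c; rewrite !mulgA mulgV mul1g => ->.
    by rewrite mulgK.
  by rewrite h0g mulVg.
apply: eq_card0 => h; rewrite !inE; apply/negP => /andP [Gh hg].
case/negP: nr; apply/exists_inP; exists h => //.
by rewrite -(inj_eq (mulIg g)) mulVg.
Qed.

Lemma card_inverting_pairs G : #|inverting_pairs G 1| = (\sum_(g in G | real_elt G g) #|'C_G[g]|)%N.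
Proof.
rewrite -sum1_card (partition_big (fun u => u.1) (mem G)) => [|u]; last first.
  by rewrite !inE => /andP [/andP []].
rewrite [RHS]big_mkcondr; apply: eq_bigr => g Gg.
rewrite -card_inverting_with // -sum1_card.
rewrite [RHS](reindex_onto (fun u : gT * gT => u.2) (fun h => (g, h))) //=.
apply: eq_bigl => -[g' h]; rewrite !inE /=.
rewrite xpair_eqE eqxx andbT [g == g']eq_sym.
by have [->|_] := eqVneq g' g; rewrite ?andbF // -/(g \in G) (Gg : g \in G) /= !andbT.
Qed.

(** Each real class contributes its size times the order of a centraliser, which is the group
    order. *)
Lemma card_real_classes G : (#|real_classes G| * #|G|)%N = #|inverting_pairs G 1|.
Proof.
rewrite card_inverting_pairs (@set_partition_big_cond _ _ _ _ _ _ _ _ (classes_partition G)).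
rewrite -sum_nat_const big_mkcond [RHS]big_mkcond; apply: eq_bigr => C _.
rewrite inE; case: imsetP => [[x Gx ->]|] //=.
have real_class y : y \in x ^: G -> real_elt G y = real_elt G x.
  by case/imsetP => z Gz ->; apply: real_eltJ.
case: ifPn => [/forall_inP H|nr].
  have rx : real_elt G x by apply: H; apply: class_refl.
  rewrite (eq_bigr (fun=> #|'C_G[x]|)) => [|y /andP [/imsetP [z Gz ->] _]]; last first.
    by rewrite -{1}(conjGid Gz) cent1J -conjIg cardJg.
  rewrite (eq_bigl (mem (x ^: G))) => [|y]; last first.
    by rewrite -[RHS]/(y \in x ^: G); case yx: (y \in x ^: G) => //=; rewrite real_class.
  rewrite sum_nat_const -index_cent1 mulnC Lagrange //.
  exact: subsetIl.
rewrite big_pred0 // => y; apply/negP => /andP [yx ry]; case/negP: nr.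
by apply/forall_inP => z zx; rewrite real_class // -(real_class y).
Qed.

End RealClassCount.

(** * Passage to the quotient by the squares of a central cyclic group *)

Section CentralQuotient.

Import GroupScope.

Variables (gT : finGroupType) (G Y : {group gT}) (alpha : gT).
Hypotheses (alphaZ : alpha \in 'Z(G)) (Y_alpha : Y :=: <[alpha ^+ 2]>).

Let G_alpha k : alpha ^+ k \in G.
Proof. by apply: groupX; apply: (subsetP (center_sub G)). Qed.

Let alpha_comm k x : x \in G -> alpha ^+ k * x = x * alpha ^+ k.
Proof.
move=> Gx; have /centerP [_ c] : alpha ^+ k \in 'Z(G) by apply: groupX.
exact: c.
Qed.

Let sYG : Y \subset G.
Proof. by rewrite Y_alpha cycle_subG. Qed.

Let nYG : G \subset 'N(Y).
Proof.
apply: subset_trans (cents_norm (_ : G \subset 'C(Y))) => //.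
rewrite centsC Y_alpha cycle_subG; apply/centP => x Gx.
exact: alpha_comm.
Qed.

Let Y_elt y : y \in Y -> exists k, y = alpha ^+ (k + k).
Proof.
rewrite Y_alpha => /cycleP [k ->]; exists k.
by rewrite -expgM mul2n addnn.
Qed.

Lemma card_inverting_pairs_translate y : y \in Y ->
  #|inverting_pairs G y| = #|inverting_pairs G 1|.
Proof.
case/Y_elt => k ->; pose f (u : gT * gT) := (u.1 * alpha ^+ k, u.2).
have f_inj : injective f by move=> [a b] [c d] [/mulIg -> ->].
rewrite -[RHS](card_imset _ f_inj); apply: eq_card => -[g h].
have key g' : g' \in G -> h \in G ->
    h * (g' * alpha ^+ k) * h^-1 * (g' * alpha ^+ k) = h * g' * h^-1 * g' * alpha ^+ (k + k).
  move=> Gg Gh; rewrite expgD !mulgA; congr (_ * _).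
  rewrite -!mulgA; congr (_ * (_ * _)).
  by rewrite (alpha_comm k (groupM (groupVr Gh) Gg)) !mulgA.
apply/idP/imsetP.
  rewrite !inE /= => /andP [/andP [Gg Gh] /eqP e].
  have Gg' : g * (alpha ^+ k)^-1 \in G by rewrite groupM // groupV.
  exists (g * (alpha ^+ k)^-1, h); last by rewrite /f /= mulgKV.
  rewrite !inE /= Gg' Gh /= -(inj_eq (mulIg (alpha ^+ (k + k)))) -key // mulgKV e mul1g.
  by [].
case=> -[g' h']; rewrite !inE /= => /andP [/andP [Gg Gh] /eqP e] [-> hh].
subst h'; rewrite groupM //= Gh key // e mul1g.
by rewrite eqxx.
Qed.

Lemma card_coset_fibre (a : coset_of Y) : a \in G / Y ->
  #|[set g in G | coset Y g == a]| = #|Y|.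
Proof.
case/morphimP => x Nx Gx ->; rewrite -(card_rcoset Y x); apply: eq_card => g.
rewrite inE; apply/andP/idP => [[Gg /eqP e]|gx].
  by apply/rcoset_kercosetP => //; apply: (subsetP nYG).
have Gg : g \in G.
  by case/rcosetP: gx => y Yy ->; rewrite groupM // (subsetP sYG).
split=> //; apply/eqP/rcoset_kercosetP => //.
exact: (subsetP nYG).
Qed.

(** Pairs with [h * g * h^-1 * g] in [Y] are counted twice: over their images in the quotient, with
    fibres of size [#|Y| ^ 2], and over the value in [Y], where all [#|Y|] counts agree. One factor
    [#|Y|] cancels. *)
Lemma card_quotient_inverting_pairs :
  (#|Y| * #|inverting_pairs (G / Y) 1|)%N = #|inverting_pairs G 1|.
Proof.
apply/eqP; rewrite -(eqn_pmul2l (cardG_gt0 Y)).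
apply/eqP; transitivity #|[set u in setX G G | u.2 * u.1 * u.2^-1 * u.1 \in Y]|.
  rewrite -[RHS]sum1_card.
  rewrite (partition_big (fun u => (coset Y u.1, coset Y u.2)) (mem (inverting_pairs (G / Y) 1))).
    rewrite mulnA mulnC -sum_nat_const; apply: eq_bigr => -[a b].
    rewrite inE => /andP [/setXP /= [Ga Gb] /eqP ab].
    rewrite -{1}(card_coset_fibre Ga) -(card_coset_fibre Gb) -cardsX -sum1_card.
    apply: eq_bigl => -[g h]; rewrite !inE /= xpair_eqE.
    case Gg: (g \in G) => //=; case Gh: (h \in G) => //=; last by rewrite andbF.
    case: eqP => [ga|] //=; last by rewrite andbF.
    case: eqP => [hb|] //=; rewrite ?andbF //= andbT.
    have Ng := subsetP nYG g Gg; have Nh := subsetP nYG h Gh.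
    apply/esym/idP/coset_idr; first by rewrite !groupM ?groupV.
    by rewrite !morphM ?groupM ?groupV // morphV //= ga hb.
  move=> [g h]; rewrite !inE /= => /andP [/andP [Gg Gh] gh].
  have Ng := subsetP nYG g Gg; have Nh := subsetP nYG h Gh.
  rewrite !mem_quotient //=; apply/eqP.
  by rewrite -morphV // -!morphM ?groupM ?groupV //; apply: coset_id.
rewrite -sum1_card (partition_big (fun u => u.2 * u.1 * u.2^-1 * u.1) (mem Y)) => [|u]; last first.
  by rewrite inE => /andP [].
rewrite -sum_nat_const; apply: eq_bigr => y Yy.
rewrite -(card_inverting_pairs_translate Yy) -sum1_card; apply: eq_bigl => u.
by rewrite !inE; have [->|_] := eqVneq (_ * u.1) y; rewrite ?(Yy : y \in Y) ?andbT ?andbF.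
Qed.

Lemma card_real_classes_quotient : #|real_classes (G / Y)| = #|real_classes G|.
Proof.
apply/eqP; rewrite -(eqn_pmul2r (cardG_gt0 G)) card_real_classes.
rewrite -card_quotient_inverting_pairs -card_real_classes mulnCA.
by rewrite /= card_quotient // Lagrange.
Qed.

(** If [h] inverts [g] up to [alpha ^+ (k + k)], it inverts [g' = g * (alpha ^+ k)^-1] exactly. An
    element [t] of square 1 that inverts [g'] then inverts [g] modulo [Y], and its image still has
    square 1. *)
Lemma strongly_real_classes_quotient :
  (forall g, g \in G -> real_elt G g -> strongly_real_elt G g) ->
  strongly_real_classes (G / Y) = real_classes (G / Y).
Proof.
move=> strong; apply/setP => C; rewrite !inE; case CG: (C \in _) => //=.
have CsG a : a \in C -> a \in G / Y.
  case/imsetP: CG => b Gb -> /imsetP [c Gc ->]; exact: groupJ.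
apply/forall_inP/forall_inP => H a Ca; have := H a Ca.
  by case/exists_inP => h Gh /andP [_ ha]; apply/exists_inP; exists h.
case/exists_inP => _ /morphimP [h Nh Gh ->] /eqP.
have /morphimP [g Ng Gg ->] := CsG a Ca.
rewrite -!morphV // -!morphM ?groupM ?groupV // => e.
have /rcosetP [y /Y_elt [k ->] hg] : h * g * h^-1 \in Y :* g^-1.
  by apply/rcoset_kercosetP; rewrite ?groupM ?groupV.
pose g' := g * (alpha ^+ k)^-1; have Gg' : g' \in G by rewrite groupM ?groupV.
have gE : g = g' * alpha ^+ k by rewrite mulgKV.
have : real_elt G g'.
  apply/exists_inP; exists h => //.
  have ah : (alpha ^+ k)^-1 * h^-1 = h^-1 * (alpha ^+ k)^-1.
    by rewrite -!invMg alpha_comm.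
  rewrite /g' invMg invgK -!mulgA ah !mulgA hg expgD -(mulgA (alpha ^+ k)).
  by rewrite (alpha_comm k (groupVr Gg)) mulgA mulgK (alpha_comm k (groupVr Gg)).
move/(strong g' Gg') => /exists_inP [t Gt /andP [/eqP tt /eqP tg]].
have Nt := subsetP nYG t Gt.
apply/exists_inP; exists (coset Y t); first exact: mem_quotient.
rewrite -morphX // tt morph1 eqxx /=.
rewrite -!morphV // -!morphM ?groupM ?groupV //.
apply/eqP/rcoset_kercosetP; rewrite ?groupM ?groupV //.
apply/rcosetP; exists (alpha ^+ (k + k)).
  rewrite Y_alpha addnn -mul2n expgM; exact: mem_cycle.
rewrite {1}gE mulgA -(mulgA (t * g')) (alpha_comm k (groupVr Gt)) mulgA tg.
by rewrite /g' invMg invgK expgD -!(mulgA (alpha ^+ k)) (alpha_comm k (groupVr Gg)).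
Qed.

End CentralQuotient.

(** * Types of the elements of GL_n(q) *)

Section GeneralLinearTypes.

Variables (F : finFieldType) (m : nat).
Local Notation n := m.+1.
Local Notation gT := {'GL_n[F]}.
Local Notation q := #|F|.
Implicit Types (x : gT) (s t : seq ({poly F} * nat)).

Lemma GL_lift (P : 'M[F]_n) : P \in unitmx -> exists x : gT, GLval x = P.
Proof. by move=> Pu; exists (FinRing.unit _ (Pu : P \is a GRing.unit)). Qed.

Lemma GLval_inj : injective (@GLval n F).
Proof. exact: val_inj. Qed.

Lemma GL_class_hsim x (y : gT) : (y \in (x ^: [set: gT])%g) <-> hsim (GLval x) (GLval y).
Proof.
split=> [/imsetP [h _ ->]|[P [Q [PQ QP PB]]]].
  exists (GLval h), (GLval h^-1); rewrite -!GL_MxE mulgV mulVg GL_1E; split=> //.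
  by rewrite conjgE !mulgA mulgV mul1g.
have [h hP] := GL_lift (mulmx1_unit PQ).1.
apply/imsetP; exists h => //; apply: (mulgI h); apply: GLval_inj.
by rewrite conjgE !mulgA mulgV mul1g !GL_MxE hP.
Qed.

Lemma GL_inverse_hsim x :
  (exists h : gT, (h * x * h^-1 = x^-1)%g) <-> hsim_inv (GLval x) (GLval x).
Proof.
split=> [[h e]|[P [Q [PQ QP PB]]]].
  exists (GLval h), (GLval h^-1); rewrite -!GL_MxE mulgV mulVg GL_1E; split=> //.
  have hx : (h * x = x^-1 * h)%g by rewrite -e mulgKV.
  by congr (GLval _); rewrite -mulgA hx mulgA mulgV mul1g.
have [h hP] := GL_lift (mulmx1_unit PQ).1.
exists h^-1%g; have e : (x * h * x)%g = h by apply: GLval_inj; rewrite !GL_MxE hP.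
have xh : (x * h = h * x^-1)%g by rewrite -{2}e mulgK.
by rewrite invgK -mulgA xh mulgA mulVg mul1g.
Qed.

Local Notation U := {ffun 'I_n.+1 -> {poly_(n.+1) F}}.
Implicit Types u v : U.

(** Types are finite functions into polynomials of bounded size, so that they form a finite type
    over which classes can be summed. *)
Definition has_type x u := exists s, [/\ primary_type s, nonzero_type s,
  hsim (GLval x) (bdiag (elementary_divisors s)) & forall i : 'I_n.+1, u i = type_poly s i :> {poly F}].

(** The weighted degree does not see index 0, hence the separate condition that the polynomial there
    has size 1. *)
Definition valid_type u :=
  [&& [forall i, mpoly0 (u i)], size (u ord0) == 1%N
    & (\sum_(i < n.+1) i * (size (u i)).-1)%N == n].

Lemma has_type_bound x s : primary_type s -> hsim (GLval x) (bdiag (elementary_divisors s)) ->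
  forall y, y \in s -> (y.2 <= n)%N.
Proof. by move=> Hs /hsim_size {1}->; apply: type_bound. Qed.

Lemma type_poly_out s i : (forall y, y \in s -> y.2 != i) -> type_poly s i = 1.
Proof.
move=> h; rewrite /type_poly big_seq_cond big_pred0 // => y.
by apply/negP => /andP [ys yi]; case/negP: (h y ys).
Qed.

Lemma nonzero_det s : primary_type s -> \det (bdiag (elementary_divisors s)) != 0 -> nonzero_type s.
Proof.
elim: s => // y s IH /primary_type_cons [[[my irr] y2] Hs] /=.
rewrite det_ublock mulf_eq0 negb_or => /andP [dy /(IH Hs) ->]; rewrite andbT /mpoly0 my.
apply: contraNneq dy => y0; rewrite det_companion ?monic_exp // signed_constX //.
by rewrite /signed_const y0 mulr0 expr0n gtn_eqF.
Qed.

Lemma type_poly_size s i : primary_type s ->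
  (i * (size (type_poly s i)).-1 <= bdim (elementary_divisors s))%N.
Proof.
elim: s => [|y s IH]; first by rewrite /type_poly big_nil size_poly1 muln0.
case/primary_type_cons => -[[my irr] y2] Hs; have {}IH := IH Hs.
rewrite type_poly_cons /= size_exp; case: eqP => [yi|_]; last first.
  by rewrite mul1r; apply: leq_trans IH (leq_addl _ _).
subst i.
have m2 := type_poly_monic y.2 Hs.
rewrite size_monicM ?monic_neq0 // (monic_size m2) (monic_size my) addnS /= mulnDr.
by rewrite [X in (X + _ <= _)%N]mulnC leq_add2l.
Qed.

Lemma dvd_type_poly s y : y \in s -> y.1 %| type_poly s y.2.
Proof. by move=> ys; rewrite /type_poly (big_rem y) //= eqxx dvdp_mulr. Qed.

Lemma exists_has_type x : exists u, has_type x u /\ valid_type u.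
Proof.
have [s [Hs sim]] := primary_decomposition (GLval x).
have hs : nonzero_type s.
  apply: nonzero_det => //; rewrite -(hsim_det sim) -unitfE -unitmxE.
  exact: GL_unitmx.
have nE := hsim_size sim; have bound := has_type_bound Hs sim.
have sz (i : 'I_n.+1) : (size (type_poly s i) <= n.+1)%N.
  case: i => -[|i] ilt /=.
    rewrite type_poly_out ?size_poly1 // => y ys.
    by case: (Hs y ys); case: (y.2).
  have := type_poly_size i.+1 Hs; rewrite -nE mulSn.
  have := monic_size (type_poly_monic i.+1 Hs).
  by move: (size _) => a; move: (i * _)%N => b; lia.
exists [ffun i : 'I_n.+1 => npolyp n.+1 (type_poly s i)].
have uE (i : 'I_n.+1) : ([ffun i : 'I_n.+1 => npolyp n.+1 (type_poly s i)] : U) i = type_poly s i :> {poly F}.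
  by rewrite ffunE npolypK.
split; first by exists s.
apply/and3P; split.
- by apply/forallP => i; rewrite uE mpoly0_type_poly.
- rewrite uE type_poly_out ?size_poly1 // => y ys.
  by case: (Hs y ys); case: (y.2).
- apply/eqP; rewrite [RHS]nE (bdim_type Hs bound); apply: eq_bigr => i _.
  by rewrite uE.
Qed.

Lemma has_type_det x u : has_type x u -> \det (GLval x) = \prod_(i < n.+1) signed_const (u i) ^+ i.
Proof.
case=> s [Hs hs sim uE]; rewrite (hsim_det sim) (det_type Hs (has_type_bound Hs sim)).
by apply: eq_bigr => i _; rewrite uE.
Qed.

Lemma has_type_self_inverse x u : has_type x u ->
  (exists h : gT, (h * x * h^-1 = x^-1)%g) <-> (forall i, recip (u i) = u i :> {poly F}).
Proof.
case=> s [Hs hs sim uE]; have bound := has_type_bound Hs sim.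
rewrite GL_inverse_hsim (self_inverse_type Hs hs sim) self_recip_type //.
split=> H i; first by rewrite uE H.
have [lt|ge] := ltnP i n.+1; first by have := H (Ordinal lt); rewrite uE.
rewrite type_poly_out ?recip1 // => y /bound yn.
by rewrite neq_ltn (leq_ltn_trans yn).
Qed.

Lemma has_type_class x (y : gT) u v : has_type x u -> has_type y v ->
  (u == v) = (y \in (x ^: [set: gT])%g).
Proof.
move=> [s [Hs hs sx uE]] [t [Ht ht ty vE]]; apply/eqP/idP => [uv|].
  apply/GL_class_hsim; apply: hsim_trans (sx) _; apply: hsim_trans (hsim_sym ty).
  apply: bdiag_perm; apply: perm_map; apply: type_poly_inj => // i.
  have [lt|ge] := ltnP i n.+1.
    by rewrite -[i]/(val (Ordinal lt)) -uE -vE uv.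
  rewrite !type_poly_out // => z zs; rewrite neq_ltn (leq_ltn_trans _ ge) //.
    exact: (has_type_bound Ht ty).
  exact: (has_type_bound Hs sx).
move/GL_class_hsim => xy; apply/ffunP => i; apply: val_inj.
rewrite /= uE vE; apply: type_poly_perm; apply: hsim_perm => //.
exact: hsim_trans (hsim_sym sx) (hsim_trans xy ty).
Qed.

Lemma has_type_surjective u : valid_type u -> exists x, has_type x u.
Proof.
case/and3P => /forallP mu /eqP u0 /eqP su.
pose w i : {poly F} := if insub i is Some j then u j else 1.
have mw i : w i \is monic by rewrite /w; case: insubP => [j _ _|_]; [case/andP: (mu j) | apply: rpred1].
have [s [Hs sE]] := exists_type n mw.
have bound y : y \in s -> (y.2 <= n)%N.
  move=> ys; rewrite leqNgt; apply/negP => lt; have := dvd_type_poly ys.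
  rewrite sE (leqNgt y.2) lt andbF dvdp1.
  by case: (Hs y ys) => -[_ [s1 _]] _; case: (size y.1) s1 => [|[]].
have uE (i : 'I_n.+1) : u i = type_poly s i :> {poly F}.
  rewrite sE /w valK; have [->|i0] := eqVneq i ord0.
    by apply: monic_deg0; [case/andP: (mu ord0) | rewrite u0].
  rewrite lt0n; rewrite -val_eqE /= in i0; rewrite i0 -ltnS ltn_ord.
  by [].
have dimE : bdim (elementary_divisors s) = n.
  by rewrite (bdim_type Hs bound) -[RHS]su; apply: eq_bigr => i _; rewrite uE.
have hs : nonzero_type s.
  apply/allP => y ys; have yn : (y.2 < n.+1)%N by apply: bound.
  have := dvd_type_poly ys; rewrite -[y.2]/(val (Ordinal yn)) -uE => dvd.
  rewrite /mpoly0 (mpoly0_dvd (mu _) dvd) andbT.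
  by case: (Hs y ys) => -[].
have Bu : castmx (dimE, dimE) (bdiag (elementary_divisors s)) \in unitmx.
  rewrite unitmxE unitfE -(hsim_det (hsim_cast dimE _)) (det_type Hs bound).
  apply/prodf_neq0 => i _; rewrite expf_neq0 // /signed_const mulf_neq0 ?signr_eq0 //.
  by rewrite -uE; case/andP: (mu i).
have [x xE] := GL_lift Bu; exists x, s; split=> //.
by rewrite xE; apply: hsim_sym; apply: hsim_cast.
Qed.

End GeneralLinearTypes.

(** * Determinants on the centraliser of an element of GL_n(q) *)

Section CentralizerDeterminants.

Variables (F : finFieldType) (m : nat).
Local Notation n := m.+1.
Local Notation gT := {'GL_n[F]}.
Local Notation U := {ffun 'I_n.+1 -> {poly_(n.+1) F}}.
Implicit Types (x : gT) (u : U) (s t : seq ({poly F} * nat)).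

Lemma has_type_strongly_real x u : (4 %| n)%N -> x \in SL n F -> has_type x u ->
  (forall i, recip (u i) = u i :> {poly F}) -> strongly_real_elt (SL n F) x.
Proof.
move=> n4 xSL xu ru; have [s [Hs hs sim uE]] := xu.
have /GL_inverse_hsim := (has_type_self_inverse xu).2 ru.
move/(self_inverse_type Hs hs sim)/(balanced_type Hs hs)/(balanced_hsim (hsim_sym sim)) => bal.
have [h [hh xhx dh]] : inverted (GLval x) 1.
  case: bal => [[]//|[k [nk]]]; have -> // : (-1) ^+ k = 1 :> F.
  rewrite -signr_odd (_ : odd k = false) //; apply/negbTE.
  by move: n4; rewrite nk addnn -muln2 (@dvdn_pmul2r 2 2) // dvdn2.
have [y yh] := GL_lift (mulmx1_unit hh).1.
apply/exists_inP; exists y; first by rewrite inE yh dh.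
have yy : (y * y = 1)%g by apply: GLval_inj; rewrite GL_MxE GL_1E yh.
have xyx : (x * y * x = y)%g by apply: GLval_inj; rewrite !GL_MxE yh.
rewrite expgS expg1 yy eqxx /=; apply/eqP.
have yx : (y * x = x^-1 * y)%g by rewrite -{2}xyx !mulgA mulVg mul1g.
by rewrite yx mulgK.
Qed.

Lemma det_GL_unit x : \det (GLval x) \is a GRing.unit.
Proof. by rewrite -unitmxE GL_unitmx. Qed.

Definition GL_det x : {unit F} := FinRing.unit F (det_GL_unit x).

Lemma GL_detM : {in [set: gT] &, {morph GL_det : x y / (x * y)%g}}.
Proof. by move=> x y _ _; apply: val_inj; rewrite /= det_mulmx. Qed.

Canonical GL_det_morphism := Morphism GL_detM.

Lemma GL_det_ker : ('ker GL_det)%g = SL n F :> {set gT}.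
Proof.
apply/setP => x; rewrite !inE /=; apply/eqP/eqP => [/(congr1 val) //|dx].
by apply: val_inj.
Qed.

Lemma GL_det_surj : (GL_det @* [set: gT])%g = [set: {unit F}].
Proof.
apply/eqP; rewrite eqEsubset subsetT; apply/subsetP => c _.
pose d : 'rV[F]_n := \row_j (if j == 0 then val c else 1).
have dE : \det (diag_mx d) = val c.
  rewrite det_diag (bigD1 0) //= mxE eqxx big1 ?mulr1 // => i i0.
  by rewrite mxE (negPf i0).
have [x xE] : exists x, GLval x = diag_mx d.
  by apply: GL_lift; rewrite unitmxE dE (valP c).
apply/morphimP; exists x; rewrite ?inE //.
by apply: val_inj; rewrite /= xE dE.
Qed.

Lemma card_GL_SL : (#|SL n F| * #|F|.-1 = #|[set: gT]|)%N.
Proof.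
rewrite -GL_det_ker -card_finField_unit -GL_det_surj card_morphim setTI.
by rewrite Lagrange ?subsetT.
Qed.

Lemma card_cent_SL x : (#|'C_(SL n F)[x]%g| * #|(GL_det @* 'C[x])%g| = #|'C[x]%g|)%N.
Proof.
rewrite card_morphim setTI GL_det_ker setIC.
exact: LagrangeI 'C[x]%G (SL_group n F).
Qed.

Definition type_gcd u := \big[gcdn/#|F|.-1]_(i < n.+1 | (1 < size (u i))%N) (i : nat).

Lemma type_gcd_dvd u : (type_gcd u %| #|F|.-1)%N.
Proof.
rewrite /type_gcd; elim/big_rec: _ => // i k _; apply: dvdn_trans.
exact: dvdn_gcdr.
Qed.

Lemma type_gcd_dvd_part u (i : 'I_n.+1) : (1 < size (u i))%N -> (type_gcd u %| i)%N.
Proof.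
move=> ui; rewrite /type_gcd; have : i \in index_enum 'I_n.+1 by rewrite mem_index_enum.
elim: (index_enum _) => // j r IH; rewrite inE big_cons => /predU1P [<-|/IH {}IH].
  by rewrite ui dvdn_gcdl.
by case: ifP => // _; apply: dvdn_trans IH; apply: dvdn_gcdr.
Qed.

Lemma cent_det_cycle x u w : [set: {unit F}] = <[w]>%g -> has_type x u ->
  (GL_det @* 'C[x] = <[w ^+ type_gcd u]>)%g.
Proof.
move=> wE [s [Hs hs sim uE]]; have bound := has_type_bound Hs sim.
have q1 : (0 < #|F|.-1)%N by have := finNzRing_gt1 F; case: #|F| => [|[]].
have w_ord : #[w]%g = #|F|.-1 by rewrite -card_finField_unit wE.
have h_gt0 : (0 < type_gcd u)%N by apply: dvdn_gt0 (type_gcd_dvd u).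
apply/eqP; rewrite eqEsubset; apply/andP; split.
  apply/subsetP => _ /morphimP [z _ zx ->].
  have xz : GLval x *m GLval z = GLval z *m GLval x.
    by rewrite -!GL_MxE; congr (GLval _); apply/esym/cent1P.
  have [|y yE] := det_commutant_sub Hs sim xz h_gt0.
    move=> a as_; have an := bound a as_.
    apply: (@type_gcd_dvd_part u (Ordinal (an : a.2 < n.+1)%N)); rewrite uE /=.
    have /dvdp_leq := dvd_type_poly as_; case: (Hs a as_) => -[_ [s1 _]] _.
    move=> le; apply: leq_trans s1 (le _).
    by rewrite monic_neq0 // type_poly_monic.
  have y0 : y \is a GRing.unit.
    by have := det_GL_unit z; rewrite yE unitrX_pos.
  have : FinRing.unit F y0 \in <[w]>%g by rewrite -wE inE.
  case/cycleP => k kE; suff zE : GL_det z = ((w ^+ type_gcd u) ^+ k)%g by rewrite /= zE mem_cycle.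
  apply: val_inj; rewrite /= yE -expgM mulnC expgM -kE.
  by rewrite FinRing.val_unitX.
(* The exponents e for which w^e is a determinant contain q - 1 and every part that occurs, and by
   Bezout they are closed under gcd; the induction follows the fold defining [type_gcd]. *)
rewrite cycle_subG; rewrite /type_gcd.
elim/big_rec: _ => [|i k ui wk].
  by rewrite -w_ord expg_order group1.
suff wi : (w ^+ i \in GL_det @* 'C[x])%g.
  have [->|i0] := posnP i; first by rewrite gcd0n.
  have [a _ /dvdnP [b bE]] := Bezoutl k i0.
  have : (w ^+ (gcdn i k + a * k) \in GL_det @* 'C[x])%g by rewrite bE mulnC expgM groupX.
  rewrite expgD groupMr //; rewrite mulnC expgM; exact: groupX.
have : exists2 a, a \in s & a.2 = i.
  have [[a as_ ai]|no] := altP (@hasP _ (fun a => a.2 == i :> nat) s).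
    by exists a => //; apply/eqP.
  move: ui; rewrite uE type_poly_out ?size_poly1 // => a as_.
  by apply: contra no => ai; apply/hasP; exists a.
case=> a as_ ai; have w0 : val w != 0 by rewrite -unitfE (valP w).
have [z [xz dz]] := commutant_det_surjective Hs sim as_ w0.
have [y yz] : exists y : gT, GLval y = z.
  by apply: GL_lift; rewrite unitmxE dz unitrX // (valP w).
apply/morphimP; exists y; first exact: in_setT.
  by apply/cent1P/GLval_inj; rewrite !GL_MxE yz.
by apply: val_inj; rewrite FinRing.val_unitX /= yz dz ai.
Qed.

Lemma card_cent_det x u : has_type x u ->
  (#|(GL_det @* 'C[x])%g| * type_gcd u = #|F|.-1)%N.
Proof.
have /cyclicP [w wE] := field_unit_group_cyclic [set: {unit F}]%G.
have w_ord : #[w]%g = #|F|.-1 by rewrite -card_finField_unit wE.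
move=> xu; rewrite (cent_det_cycle wE xu) -orderE orderXdiv w_ord ?type_gcd_dvd //.
by rewrite divnK ?type_gcd_dvd.
Qed.

End CentralizerDeterminants.

(** * Real classes of SL_n(q) as a sum over real types *)

Section RealClassesSL.

Variables (F : finFieldType) (m : nat).
Local Notation n := m.+1.
Local Notation gT := {'GL_n[F]}.
Local Notation U := {ffun 'I_n.+1 -> {poly_(n.+1) F}}.
Implicit Types (x : gT) (u : U).

Definition real_type u :=
  [&& valid_type u, [forall i, recip (u i) == u i :> {poly F}]
    & \prod_(i < n.+1) signed_const (u i) ^+ i == 1].

(** Being inverted in GL_n(q) is enough: when 4 divides n an inverting element can be found in
    SL_n(q). *)
Lemma real_SL_type x u : (4 %| n)%N -> has_type x u -> valid_type u ->
  (x \in SL n F) && real_elt (SL n F) x = real_type u.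
Proof.
move=> n4 xu vu; rewrite /real_type vu inE (has_type_det xu) /= andbC.
case: (boolP (_ == 1)) => [/eqP d1|_]; last by rewrite !andbF.
rewrite !andbT; have xSL : x \in SL n F by rewrite inE (has_type_det xu) d1.
apply/exists_inP/forallP => [[h _ /eqP e] i|r].
  by apply/eqP; apply: (has_type_self_inverse xu).1; exists h.
have /(has_type_strongly_real n4 xSL xu) : forall i, recip (u i) = u i :> {poly F}.
  by move=> i; apply/eqP.
by case/exists_inP => h hSL /andP [_ e]; exists h.
Qed.

Lemma strongly_real_SL x : (4 %| n)%N -> x \in SL n F -> real_elt (SL n F) x ->
  strongly_real_elt (SL n F) x.
Proof.
move=> n4 xSL rx; have [u [xu vu]] := exists_has_type x.
apply: (has_type_strongly_real n4 xSL xu) => i.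
have := real_SL_type n4 xu vu; rewrite xSL rx => /esym /and3P [_ /forallP r _].
exact/eqP.
Qed.

Lemma has_type_conj x (y : gT) u :
  (y \in x ^: [set: gT])%g -> has_type x u -> has_type y u.
Proof.
move=> /GL_class_hsim xy [s [Hs hs sx uE]]; exists s; split=> //.
exact: hsim_trans (hsim_sym xy) sx.
Qed.

Lemma card_real_classes_SL : (4 %| n)%N ->
  #|real_classes (SL n F)| = (\sum_(u | real_type u) type_gcd u)%N.
Proof.
move=> n4; have [f fP] := fin_all_exists (@exists_has_type F m).
have SL0 := cardG_gt0 (SL_group n F).
apply/eqP; rewrite -(eqn_pmul2r SL0) (card_real_classes (SL_group n F)) card_inverting_pairs.
rewrite (eq_bigl (fun x => real_type (f x))) => [|x]; last first.
  by have [xu vu] := fP x; rewrite -(real_SL_type n4 xu vu).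
rewrite (partition_big f real_type) //= big_distrl /=.
apply/eqP; apply: eq_bigr => u ru.
have q1 : (0 < #|F|.-1)%N by have := finNzRing_gt1 F; case: #|F| => [|[]].
(* The factor q - 1 brings in the centraliser in GL_n(q): times q - 1, the order of the centraliser
   in SL_n(q) is that of the full one times [type_gcd u], the index of its determinants. Summing the
   full centralisers over the class gives the order of GL_n(q). *)
apply/eqP; rewrite -(eqn_pmul2r q1) big_distrl /= -mulnA card_GL_SL; apply/eqP.
have [x0 x0u] : exists x0, has_type x0 u by apply: has_type_surjective; case/and3P: ru.
rewrite (eq_bigl (mem (x0 ^: [set: gT])%g)) => [|x]; last first.
  have [xu vu] := fP x; rewrite -[RHS](has_type_class x0u xu) eq_sym.
  by have [->|] := eqVneq (f x) u; rewrite ?ru ?andbF.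
rewrite (eq_bigr (fun=> #|'C[x0]%g| * type_gcd u)%N) => [|x /imsetP [h _ ->]]; last first.
  have x0h : has_type (x0 ^ h)%g u.
    by apply: has_type_conj (x0u); rewrite memJ_class ?inE.
  rewrite -(card_cent_det x0h) mulnA card_cent_SL.
  by rewrite cent1J cardJg.
rewrite sum_nat_const mulnA mulnC; congr (_ * _)%N.
by rewrite mulnC -index_cent1 setTI Lagrange ?subsetT.
Qed.

End RealClassesSL.

(** * Signed counts of self-reciprocal polynomials in odd characteristic *)

Section SelfReciprocalCount.

Variables (F : finFieldType) (n : nat).
Hypothesis two_neq0 : (1 + 1 : F) != 0.
Local Notation q := #|F|.
Local Notation P := {poly_(n.+1) F}.

Definition self_recip d : {set P} :=
  [set p : P | [&& mpoly0 p, recip p == p :> {poly F} & (size p).-1 == d]].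

Definition self_recip_const d (e : F) : {set P} :=
  [set p : P | (p \in self_recip d) && ((p : {poly F})`_0 == e)].

Lemma self_recipP d (p : P) :
  reflect [/\ (p : {poly F}) \is monic, size p = d.+1,
     (p : {poly F})`_0 ^+ 2 = 1
     & forall j, (j <= d)%N -> (p : {poly F})`_(d - j) = (p : {poly F})`_0 * (p : {poly F})`_j]
   (p \in self_recip d).
Proof.
rewrite inE; apply: (iffP and3P) => [[hp /eqP rp /eqP sp]|[mp sp p0 sym]].
  have /andP [mp p0] := hp; have sp' : size p = d.+1 by rewrite monic_size // sp.
  split=> // [|j jd].
    have := recip_coef0 hp; rewrite rp => e.
    by rewrite expr2 {1}e mulVf.
  by rewrite -{3}rp coef_recip // sp' ltnS jd /= mulrC divfK.
have p00 : (p : {poly F})`_0 != 0 by apply: contra_eq_neq p0 => ->; rewrite expr0n eq_sym oner_neq0.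
have hp : mpoly0 p by rewrite /mpoly0 mp.
split=> //; last by rewrite sp.
apply/eqP/polyP => j; rewrite coef_recip // sp ltnS.
case: leqP => [jd|dj]; last by rewrite nth_default ?sp.
by rewrite /= sym // mulrC mulKf.
Qed.

Lemma self_recip_const0 d (p : P) : p \in self_recip d ->
  ((p : {poly F})`_0 == 1) || ((p : {poly F})`_0 == -1).
Proof. by case/self_recipP => _ _ /eqP + _; rewrite sqrf_eq1. Qed.

(** The coefficients of degrees 1 to [r] are free and the symmetry gives the others. For odd [d]
    there is no middle coefficient. For even [d] the middle one is free if [e = 1]; if [e = -1] it
    equals its opposite and vanishes, because 2 is invertible. *)
Lemma card_self_recip_const d (e : F) (r : nat) : (0 < d <= n)%N ->
  e ^+ 2 = 1 -> (r < d)%N ->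
  (d = (r + r).+1 \/ (e = 1 /\ d = (r + r)%N) \/ (e = -1 /\ d = (r + r).+2)) ->
  #|self_recip_const d e| = (q ^ r)%N.
Proof.
move=> /andP [d0 dn] ee rd dE.
pose c (v : {ffun 'I_r -> F}) j := if insub j.-1 is Some i then v i else 0.
pose coefs v j := if j == 0%N then e else if j == d then 1 else
  if (j <= r)%N then c v j else if (d - j <= r)%N then e * c v (d - j)%N else 0.
pose f v : P := npolyp n.+1 (\poly_(j < d.+1) coefs v j).
have fE v : f v = \poly_(j < d.+1) coefs v j :> {poly F}.
  by rewrite npolypK // (leq_trans (size_poly _ _)).
have coef_f v j : (f v : {poly F})`_j = if (j <= d)%N then coefs v j else 0.
  by rewrite fE coef_poly ltnS.
have coefs0 v : coefs v 0%N = e by [].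
have coefsd v : coefs v d = 1 by rewrite /coefs gtn_eqF // eqxx.
have sym v j : (j <= d)%N -> coefs v (d - j)%N = e * coefs v j.
  have [->|j0] := eqVneq j 0%N; first by rewrite subn0 coefsd coefs0 -expr2 ee.
  have [->|jd] := eqVneq j d; first by rewrite subnn coefsd coefs0 mulr1.
  move=> jled; rewrite /coefs (negPf j0) (negPf jd).
  rewrite (_ : (d - j == 0)%N = false); last by lia.
  rewrite (_ : (d - j == d)%N = false); last by lia.
  rewrite subKn //; case: (leqP j r) => jr; case: (leqP (d - j) r) => djr //.
  - have e1 : e = 1 by case: dE => [|[[]|[]]] //; lia.
    by rewrite e1 mul1r; congr (c v _); case: dE => [|[[_]|[_]]]; lia.
  - by rewrite mulrA -expr2 ee mul1r.
  - by rewrite mulr0.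
have f_in v : f v \in self_recip_const d e.
  have sz : size (f v) = d.+1.
    by rewrite fE size_poly_eq // coefsd oner_neq0.
  rewrite inE coef_f /= coefs0 eqxx andbT; apply/self_recipP; split=> //.
  - by rewrite monicE lead_coefE sz /= coef_f leqnn coefsd.
  - by rewrite coef_f /= coefs0.
  - by move=> j jd; rewrite !coef_f leq_subr jd /= coefs0 sym.
have cK v (i : 'I_r) : c v i.+1 = v i by rewrite /c /= valK.
have f_inj : injective f.
  move=> v w fvw; apply/ffunP => i; have := congr1 (fun p : P => (p : {poly F})`_i.+1) fvw.
  have ir := ltn_ord i.
  rewrite /= !coef_f (_ : (i.+1 <= d)%N = true); last by lia.
  rewrite /coefs /= (_ : (i.+1 == d)%N = false); last by lia.
  by rewrite ir !cK.
have <- : f @: [set: {ffun 'I_r -> F}] = self_recip_const d e.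
  apply/eqP; rewrite eqEsubset; apply/andP; split; first by apply/subsetP => _ /imsetP [v _ ->].
  apply/subsetP => p; rewrite inE => /andP [/self_recipP [mp sp p0 psym] /eqP pe].
  apply/imsetP; exists [ffun i : 'I_r => (p : {poly F})`_i.+1] => //.
  set v := finfun _; apply: val_inj; apply/polyP => j; rewrite [RHS]coef_f.
  have cv k : (0 < k <= r)%N -> c v k = (p : {poly F})`_k.
    case: k => // k /= kr; rewrite /c /= (insubT (fun i => (i < r)%N) kr) ffunE.
    by [].
  case: leqP => [jd|dj]; last by rewrite nth_default ?sp.
  rewrite /coefs; have [->|j0] := eqVneq j 0%N; first by [].
  have [->|jd'] := eqVneq j d.
    by move: mp; rewrite monicE lead_coefE sp => /eqP.
  case: (leqP j r) => jr; first by rewrite cv // lt0n j0.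
  case: (leqP (d - j) r) => djr.
    rewrite cv; last by lia.
    by rewrite psym // pe mulrA -expr2 ee mul1r.
  have [e1 jE] : e = -1 /\ (d - j)%N = j.
    by case: dE => [|[[_]|[e1]]]; [lia | lia | split=> //; lia].
  have := psym j jd; rewrite jE pe e1 mulN1r => /eqP.
  rewrite -subr_eq0 opprK -[X in X + X]mul1r -mulrDl mulf_eq0 (negPf two_neq0).
  by move/eqP.
by rewrite card_imset // cardsT card_ffun card_ord.
Qed.

Lemma card_self_recip_const_sum d (g : F -> rat) :
  \sum_(p in self_recip d) g (p : {poly F})`_0 =
  #|self_recip_const d 1|%:R * g 1 + #|self_recip_const d (-1)|%:R * g (-1).
Proof.
have neq1 : (1 : F) != -1 by rewrite -subr_eq0 opprK.
have cst e : \sum_(p in self_recip_const d e) g (p : {poly F})`_0 = #|self_recip_const d e|%:R * g e.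
  rewrite (eq_bigr (fun=> g e)) => [|p]; last by rewrite inE => /andP [_ /eqP ->].
  by rewrite sumr_const mulr_natl.
rewrite -!cst (bigID (fun p : P => (p : {poly F})`_0 == 1)) /=; congr (_ + _); apply: eq_bigl => p.
  by rewrite [in RHS]inE.
rewrite [in RHS]inE; case pd: (p \in self_recip d) => //=.
case/orP: (self_recip_const0 pd) => /eqP ->; last by rewrite eqxx eq_sym neq1.
by rewrite eqxx (negPf neq1).
Qed.

Lemma self_recip0 : self_recip 0 = [set npolyp n.+1 1].
Proof.
have v1 : npolyp n.+1 (1 : {poly F}) = 1 :> {poly F} by rewrite npolypK // size_poly1.
apply/setP => p; rewrite in_set1; apply/self_recipP/eqP => [[mp sp _ _]|->].
  by apply: val_inj; rewrite /= v1; apply: monic_deg0; rewrite ?sp.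
rewrite v1; split; rewrite ?rpred1 ?size_poly1 ?coef1 ?expr1n // => j.
by rewrite leqn0 => /eqP ->; rewrite coef1 mulr1.
Qed.

(** Meant for the arguments 1 and -1, where it is the embedding of signs into the rationals. *)
Definition sign_rat (x : F) : rat := if x == 1 then 1 else -1.

Lemma sign_rat1 : sign_rat 1 = 1.
Proof. by rewrite /sign_rat eqxx. Qed.

Lemma sign_ratN1 : sign_rat (-1) = -1.
Proof. by rewrite /sign_rat eq_sym -subr_eq0 opprK (negPf two_neq0). Qed.

(** For even [i] this is the number of self-reciprocal polynomials of degree [d]; for odd [i], the
    excess of those with companion determinant 1 over those with determinant -1. *)
Definition signed_sum i d : rat := \sum_(p in self_recip d) sign_rat (signed_const (p : {poly F})) ^+ i.

Lemma signed_sum0 i : signed_sum i 0 = 1.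
Proof.
rewrite /signed_sum self_recip0 big_set1 npolypK ?size_poly1 // signed_const1.
by rewrite sign_rat1 expr1n.
Qed.

Lemma signed_sumE i d : signed_sum i d =
  #|self_recip_const d 1|%:R * sign_rat ((-1) ^+ d) ^+ i +
  #|self_recip_const d (-1)|%:R * sign_rat ((-1) ^+ d * -1) ^+ i.
Proof.
have := card_self_recip_const_sum d (fun x => sign_rat ((-1) ^+ d * x) ^+ i).
rewrite mulr1 => <-.
by apply: eq_bigr => p /self_recipP [_ sp _ _]; rewrite /signed_const sp.
Qed.

(** In odd degree the two constant terms are equally frequent, each q^((d-1)/2) times, so the counts
    add up to [nq q d] and their difference vanishes. *)
Lemma signed_sum_odd i d : (d <= n)%N -> odd d ->
  signed_sum i d = if odd i then 0 else nq q d.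
Proof.
move=> dn odd_d; rewrite signed_sumE -signr_odd odd_d mulrNN mulr1 sign_rat1 sign_ratN1.
have d0 : (0 < d)%N by case: d odd_d {dn}.
have dE : d = (d./2 + d./2).+1 by rewrite addnn -[LHS]odd_double_half odd_d.
rewrite !(@card_self_recip_const d _ d./2) ?d0 ?dn ?sqrrN ?expr1n //; try lia.
rewrite -signr_odd /nq odd_d natrX mulr1; case: (odd i).
  by rewrite mulrN1 addNr.
rewrite mulr1 -mulr2n mulr_natl.
by have -> : (d.-1)./2 = d./2 by rewrite {1}dE /= addnn doubleK.
Qed.

(** In even degree the constant term 1 occurs q^(d/2) times and -1 occurs q^(d/2-1) times; sum and
    difference produce the factors q + 1 and q - 1. *)
Lemma signed_sum_even i d : (0 < d <= n)%N -> ~~ odd d ->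
  signed_sum i d = if odd i then (q%:R - 1) * q%:R ^+ (d./2).-1 else nq q d.
Proof.
move=> dn even_d; rewrite signed_sumE -signr_odd (negPf even_d) mul1r sign_rat1 sign_ratN1.
have dE : d = (d./2 + d./2)%N by rewrite addnn -[LHS]odd_double_half (negPf even_d).
rewrite (@card_self_recip_const d _ d./2) ?expr1n //; [|lia|by right; left].
rewrite (@card_self_recip_const d _ (d./2).-1) ?sqrrN ?expr1n //; [|lia|by right; right; split=> //; lia].
have d2 : (0 < d./2)%N by lia.
rewrite -signr_odd /nq (negPf even_d) !natrX mulr1 -{1}(prednK d2) exprS; case: (odd i).
  by rewrite mulrN1 mulrBl mul1r.
by rewrite mulr1 mulrDl mul1r.
Qed.

Lemma signed_sum_gt0 i d : (0 < d <= n)%N -> signed_sum i d =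
  if odd i then (if odd d then 0 else (q%:R - 1) * q%:R ^+ (d./2).-1) else nq q d.
Proof.
move=> dn; case: (boolP (odd d)) => o; last exact: signed_sum_even.
by case/andP: dn => _ dn; apply: signed_sum_odd.
Qed.

End SelfReciprocalCount.

(** * Regrouping real types by partition *)

Section PartitionSum.

Variables (F : finFieldType) (m : nat).
Hypothesis two_neq0 : (1 + 1 : F) != 0.
Local Notation n := m.+1.
Local Notation q := #|F|.
Local Notation U := {ffun 'I_n.+1 -> {poly_(n.+1) F}}.
Local Notation N := {ffun 'I_n.+1 -> 'I_n.+1}.
Implicit Types (u : U) (nu : N).

Definition type_degrees u : N := [ffun i => inord (size (u i)).-1].

Lemma type_degreesE u i : type_degrees u i = (size (u i)).-1 :> nat.
Proof.
rewrite ffunE inordK // (leq_ltn_trans _ (ltnSn n)) //.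
by have := size_npoly (u i); case: (size _).
Qed.

Lemma real_typeE u nu : is_partition nu ->
  real_type u && (type_degrees u == nu) =
  (u \in family (fun i => self_recip F n (nu i))) && (\prod_(i < n.+1) signed_const (u i) ^+ i == 1).
Proof.
move=> /andP [/eqP nu0 /eqP nuE]; rewrite /real_type.
case: (_ == 1); last by rewrite !(andbF, andFb).
rewrite !andbT; apply/andP/familyP => [[/andP [/and3P [/forallP mu _ _] /forallP ru] /eqP <-] i|H].
  by rewrite inE mu ru type_degreesE /=.
have {}H i : [/\ mpoly0 (u i), recip (u i) = u i :> {poly F} & (size (u i)).-1 = nu i].
  by have := H i; rewrite inE => /and3P [h /eqP e /eqP d].
have degE : type_degrees u = nu.
  by apply/ffunP => i; apply: val_inj; rewrite /= type_degreesE; case: (H i).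
rewrite degE eqxx; split=> //; apply/andP; split; last by apply/forallP => i; case: (H i) => _ ->.
apply/and3P; split.
- by apply/forallP => i; case: (H i).
- by case: (H ord0) => /andP [mu _] _ sz; rewrite (monic_size mu) sz nu0.
- by rewrite -[X in _ == X]nuE; apply/eqP; apply: eq_bigr => i _; case: (H i) => _ _ ->.
Qed.

(** The indicator of 1 in the group of signs is the average of its two characters. *)
Lemma sign_rat_prod (I : finType) (x : I -> F) (k : I -> nat) :
  (forall i, (x i == 1) || (x i == -1)) ->
  (\prod_i x i ^+ k i == 1)%:R = (1 + \prod_i sign_rat (x i) ^+ k i) / 2%:R :> rat.
Proof.
move=> hx; pose R (a : F) (b : rat) := (a = 1 /\ b = 1) \/ (a = -1 /\ b = -1).
have RM a a' b b' : R a b -> R a' b' -> R (a * a') (b * b').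
  by case=> [[-> ->]|[-> ->]] [[-> ->]|[-> ->]]; rewrite ?mulr1 ?mul1r ?mulrNN ?mulr1; [left|right|right|left].
have Rx i : R (x i ^+ k i) (sign_rat (x i) ^+ k i).
  elim: (k i) => [|j IH]; first by left.
  rewrite !exprS; apply: RM IH; case/orP: (hx i) => /eqP ->.
    by left; rewrite sign_rat1.
  by right; rewrite sign_ratN1.
have : R (\prod_i x i ^+ k i) (\prod_i sign_rat (x i) ^+ k i).
  by apply: (big_ind2 R) => //; [left | move=> *; apply: RM].
case=> [[-> ->]|[-> ->]]; first by rewrite eqxx.
by rewrite subrr mul0r eq_sym -subr_eq0 opprK (negPf two_neq0).
Qed.

Lemma card_real_type_degrees nu : is_partition nu ->
  #|[set u : U | real_type u & type_degrees u == nu]|%:R =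
  (\prod_(i < n.+1) signed_sum F n 0 (nu i) + \prod_(i < n.+1) signed_sum F n i (nu i)) / 2 :> rat.
Proof.
move=> nuP; rewrite cardsE -sum1_card natr_sum.
rewrite (eq_bigl (fun u => (u \in family (fun i => self_recip F n (nu i))) &&
    (\prod_(i < n.+1) signed_const (u i) ^+ i == 1))) => [|u]; last first.
  by rewrite -real_typeE.
rewrite big_mkcondr /=.
transitivity (\sum_(u in family (fun i => self_recip F n (nu i)))
    (1 + \prod_(i < n.+1) sign_rat (signed_const (u i)) ^+ i) / 2 : rat).
  apply: eq_bigr => u /familyP uf; rewrite -sign_rat_prod; first by case: eqP.
  move=> i; have := uf i; move/[dup]/self_recip_const0.
  case/orP => /eqP p0 _; rewrite /signed_const p0 -signr_odd; case: (odd _);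
    by rewrite ?expr0 ?expr1 ?mulr1 ?mulrNN ?mul1r ?eqxx ?orbT.
rewrite -mulr_suml big_split /=; congr ((_ + _) / _).
  rewrite /signed_sum bigA_distr_big_dep; apply: eq_bigr => u _.
  by rewrite big1 // => i _; rewrite expr0.
by rewrite /signed_sum bigA_distr_big_dep.
Qed.

(** Compare the two products of [card_real_type_degrees]. Without odd parts they coincide. An odd
    part of odd multiplicity makes the second one vanish. Otherwise each odd part, of even
    multiplicity, contributes a factor q + 1 to the first and q - 1 to the second, and all other
    factors are common. *)
Lemma card_real_type_sl nu : is_partition nu ->
  #|[set u : U | real_type u & type_degrees u == nu]|%:R = sl_part q nu.
Proof.
move=> nuP; rewrite card_real_type_degrees //.
have nun (i : 'I_n.+1) : (nu i <= n)%N by rewrite -ltnS.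
have prodA : \prod_(i < n.+1) signed_sum F n 0 (nu i) = \prod_(i < n.+1 | (0 < nu i)%N) nq q (nu i).
  rewrite [RHS]big_mkcond; apply: eq_bigr => i _; case: posnP => [->|i0].
    exact: signed_sum0.
  by rewrite signed_sum_gt0 ?i0 ?nun.
have evenE (i : 'I_n.+1) : ~~ odd i -> signed_sum F n i (nu i) = signed_sum F n 0 (nu i).
  move=> ei; have [->|i0] := posnP (nu i); first by rewrite !signed_sum0.
  by rewrite !signed_sum_gt0 ?i0 ?nun // (negPf ei).
rewrite /sl_part; case: ifPn => [/forallP H|_].
  rewrite [X in _ + X](_ : _ = \prod_(i < n.+1) signed_sum F n 0 (nu i)); last first.
    apply: eq_bigr => i _; case: (boolP (odd i)) => [oi|]; last exact: evenE.
    by have := H i; rewrite oi /= => /eqP ->; rewrite !signed_sum0.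
  by rewrite prodA; field.
case: ifPn => [/existsP [i oi]|/existsPn nodd].
  rewrite prodA [X in _ + X](bigD1 i) //=; move: oi; rewrite oddM => /andP [oi on].
  rewrite signed_sum_gt0 ?oi ?on ?nun ?andbT ?odd_gt0 //.
  by rewrite mul0r addr0 mulrC.
have oddE (i : 'I_n.+1) : odd i -> ~~ odd (nu i) by move=> oi; have := nodd i; rewrite oddM oi.
pose Q := \prod_(i < n.+1 | odd i && (0 < nu i)%N) (q%:R ^+ ((nu i)./2).-1 : rat).
pose E := \prod_(i < n.+1 | ~~ odd i && (0 < nu i)%N) nq q (nu i).
pose r := #|[set i : 'I_n.+1 | odd i & (0 < nu i)%N]|.
have splitP (x : rat) (f : 'I_n.+1 -> rat) :
    (forall i : 'I_n.+1, odd i -> f i = if (0 < nu i)%N then x * q%:R ^+ ((nu i)./2).-1 else 1) ->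
    (forall i : 'I_n.+1, ~~ odd i -> f i = signed_sum F n 0 (nu i)) ->
    \prod_(i < n.+1) f i = x ^+ r * Q * E.
  move=> fodd feven; rewrite (bigID (fun i : 'I_n.+1 => odd i)) /=; congr (_ * _).
    rewrite (eq_bigr _ fodd) -big_mkcondr /= big_split /= prodr_const.
    by rewrite /r cardsE.
  rewrite (eq_bigr _ feven) /E big_mkcondr; apply: eq_bigr => i ei.
  case: posnP => [->|i0]; first exact: signed_sum0.
  by rewrite signed_sum_gt0 ?i0 ?nun.
rewrite (splitP (q%:R + 1)) // => [|i oi]; last first.
  case: posnP => [->|i0]; first exact: signed_sum0.
  by rewrite signed_sum_gt0 ?i0 ?nun //= /nq (negPf (oddE i oi)).
rewrite (splitP (q%:R - 1)) // => [|i oi]; last first.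
  case: posnP => [->|i0]; first exact: signed_sum0.
  by rewrite signed_sum_gt0 ?i0 ?nun //= oi (negPf (oddE i oi)).
rewrite /f_part -/r -/Q -/E; by field.
Qed.

Lemma type_gcd_degrees u : type_gcd u = h_part q (type_degrees u).
Proof.
apply: eq_bigl => i; rewrite type_degreesE.
by case: (size _) => [|[]].
Qed.

Lemma type_degrees_partition u : real_type u -> is_partition (type_degrees u).
Proof.
case/and3P => /and3P [_ /eqP u0 /eqP us] _ _; apply/andP; split.
  by rewrite type_degreesE u0.
by rewrite -[X in _ == X]us; apply/eqP; apply: eq_bigr => i _; rewrite type_degreesE.
Qed.

Lemma sum_type_gcd :
  (\sum_(u : U | real_type u) type_gcd u)%:R =
  \sum_(nu : N | is_partition nu) (h_part q nu)%:R * sl_part q nu :> rat.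
Proof.
rewrite natr_sum (partition_big type_degrees (@is_partition n)) /=; last first.
  exact: type_degrees_partition.
apply: eq_bigr => nu nuP; rewrite -card_real_type_sl // mulr_natr cardsE -sumr_const.
apply: eq_bigr => u /andP [_ /eqP <-]; by rewrite type_gcd_degrees.
Qed.

End PartitionSum.

(** * The centre of SL_n(q) and the element alpha *)

Section Center.

Variables (F : finFieldType) (m : nat).
Local Notation n := m.+1.
Local Notation gT := {'GL_n[F]}.

Lemma det_transvection (i j : 'I_n) : i != j -> \det (1%:M + delta_mx i j : 'M[F]_n) = 1.
Proof.
have lower (k l : 'I_n) : (l < k)%N -> \det (1%:M + delta_mx k l : 'M[F]_n) = 1.
  move=> lk; rewrite det_trig => [|]; last first.
    apply/is_trig_mxP => a b ab; rewrite !mxE -val_eqE /= ltn_eqF // add0r.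
    case: eqP => [ak|] //=; case: eqP => [bl|] //=.
    by move: ab; rewrite ak bl ltnNge (ltnW lk).
  rewrite big1 // => a _; rewrite !mxE eqxx; case: eqP => [->|] //=; last by rewrite addr0.
  by rewrite -val_eqE gtn_eqF // addr0.
move=> ij; case: (ltngtP i j) => [lt|gt|/val_inj e]; last by rewrite e eqxx in ij.
  by rewrite -det_tr linearD /= trmx1 trmx_delta lower.
exact: lower.
Qed.

(** Transvections have determinant 1, and commuting with one amounts to commuting with the
    elementary matrix [delta_mx i j]. *)
Lemma center_SL_scalar (x : gT) : (x \in 'Z(SL n F))%g -> exists a, GLval x = a%:M.
Proof.
case/centerP => _ xC; set A := GLval x.
have comm i j : i != j -> A *m delta_mx i j = delta_mx i j *m A.
  move=> ij; have Tu : (1%:M + delta_mx i j : 'M[F]_n) \in unitmx.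
    by rewrite unitmxE det_transvection // unitr1.
  have [t tE] := GL_lift Tu.
  have /xC : t \in SL n F by rewrite inE tE det_transvection.
  move/(congr1 (@GLval _ _)); rewrite !GL_MxE tE mulmxDr mulmxDl mulmx1 mul1mx.
  exact: addrI.
have entry i j k : i != j -> A k i = if k == i then A j j else 0.
  move=> ij; have /matrixP/(_ k j) := comm i j ij.
  rewrite !mxE (bigD1 i) //= mxE !eqxx mulr1 big1 ?addr0 => [->|l li]; last first.
    by rewrite mxE (negPf li) mulr0.
  rewrite (bigD1 j) //= mxE eqxx andbT big1 ?addr0 => [|l lj]; last first.
    by rewrite mxE (negPf lj) andbF mul0r.
  by case: eqP; rewrite ?mul1r ?mul0r.
exists (A 0 0); apply/matrixP => k i; rewrite mxE.
have [->|ki] := eqVneq k i; last first.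
  by have ik : i != k by [rewrite eq_sym]; rewrite (entry _ _ k ik) (negPf ki).
have [->|i0] := eqVneq i 0; first by [].
by rewrite (entry i 0 i) // eqxx.
Qed.

Definition scalar_GL (c : {unit F}) : gT :=
  odflt 1%g [pick x : gT | GLval x == (val c)%:M].

Lemma scalar_GLE c : GLval (scalar_GL c) = (val c)%:M.
Proof.
rewrite /scalar_GL; case: pickP => [x /eqP //|no].
have [x xE] : exists x : gT, GLval x = (val c)%:M.
  by apply: GL_lift; rewrite unitmxE det_scalar unitrX // (valP c).
by have := no x; rewrite xE eqxx.
Qed.

Lemma scalar_GLM : {in [set: {unit F}] &, {morph scalar_GL : c d / (c * d)%g}}.
Proof.
by move=> c d _ _; apply: GLval_inj; rewrite GL_MxE !scalar_GLE -scalar_mxM.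
Qed.

Canonical scalar_GL_morphism := Morphism scalar_GLM.

Lemma scalar_GL_inj : ('injm scalar_GL)%g.
Proof.
apply/injmP => c d _ _ /(congr1 (@GLval _ _)); rewrite !scalar_GLE => /matrixP/(_ 0 0).
by rewrite !mxE eqxx => /val_inj.
Qed.

Lemma center_SL_sub : ('Z(SL n F) \subset scalar_GL @* [set: {unit F}])%g.
Proof.
apply/subsetP => x /center_SL_scalar [a xa].
have a_unit : a \is a GRing.unit.
  have : GLval x \in unitmx := GL_unitmx x.
  by rewrite xa unitmxE det_scalar unitrX_pos.
apply/morphimP; exists (FinRing.unit F a_unit); rewrite ?inE //.
by apply: GLval_inj; rewrite scalar_GLE.
Qed.

(** Scalars form a cyclic group of order q - 1, so [Y] is cyclic of order dividing q - 1; its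
    generator is a scalar of determinant 1, which is thus killed by the exponent n. *)
Lemma center_SL_order (Y : {group gT}) :
  Y \subset ('Z(SL n F))%g -> (#|Y| %| gcdn n #|F|.-1)%N.
Proof.
move=> sYZ; have sYs := subset_trans sYZ center_SL_sub.
have cyc : cyclic (scalar_GL @* [set: {unit F}])%g.
  by rewrite morphim_cyclic // field_unit_group_cyclic.
rewrite dvdn_gcd -card_finField_unit -(card_injm scalar_GL_inj (subxx _)).
rewrite cardSg ?andbT //.
have /cyclicP [t tE] := cyclicS sYs cyc; rewrite tE -orderE order_dvdn.
have tY : t \in Y by rewrite tE cycle_id.
have /morphimP [c _ _ tc] := subsetP sYs t tY.
have /setIP [] := subsetP sYZ t tY; rewrite inE tc scalar_GLE det_scalar => /eqP cn _.
apply/eqP; rewrite -(morphX scalar_GL_morphism) ?inE //=.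
by rewrite (_ : (c ^+ n)%g = 1%g) ?morph1 //; apply: val_inj; rewrite FinRing.val_unitX.
Qed.

(** Take for [alpha] a scalar of order [#|Y|.*2], namely the generator [s] to the power (q - 1) /
    (2|Y|). It has determinant 1 because its order divides n, and its square generates the unique
    subgroup of order [#|Y|] in the cyclic group of scalars. *)
Lemma center_SL_squares (Y : {group gT}) :
  Y \subset ('Z(SL n F))%g -> (#|Y|.*2 %| n)%N -> (#|Y|.*2 %| #|F|.-1)%N ->
  exists2 alpha, (alpha \in 'Z(SL n F))%g & Y = <[alpha ^+ 2]>%g :> {set gT}.
Proof.
move=> sYZ yn yq; have /cyclicP [w wE] := field_unit_group_cyclic [set: {unit F}]%G.
have w_ord : #[w]%g = #|F|.-1 by rewrite -card_finField_unit wE.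
set y := #|Y| in yn yq; have y0 : (0 < y)%N := cardG_gt0 Y.
pose k := (#|F|.-1 %/ y.*2)%N; have kE : (k * y.*2)%N = #|F|.-1 by rewrite divnK.
pose s := scalar_GL w; have s_ord : #[s]%g = #|F|.-1.
  by rewrite -w_ord; apply: (order_injm scalar_GL_inj); rewrite inE.
have sYs : Y \subset <[s]>%g.
  apply: subset_trans sYZ (subset_trans center_SL_sub _).
  apply/subsetP => _ /morphimP [c _ _ ->]; have : c \in <[w]>%g by rewrite -wE inE.
  by case/cycleP => j ->; rewrite (morphX scalar_GL_morphism) ?inE // mem_cycle.
exists (s ^+ k)%g.
  have detk : \det (GLval (s ^+ k)%g) = 1.
    rewrite /s -(morphX scalar_GL_morphism) ?inE //= scalar_GLE det_scalar.
    rewrite -FinRing.val_unitX -expgM.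
    have /dvdnP [c cE] := yn.
    by rewrite cE mulnCA kE -w_ord mulnC expgM expg_order expg1n.
  apply/centerP; split; first by rewrite inE detk.
  move=> z _; apply: GLval_inj; rewrite !GL_MxE.
  rewrite /s -(morphX scalar_GL_morphism) ?inE //= scalar_GLE.
  by rewrite scalar_mxC.
apply/eqP; rewrite (eq_subG_cyclic (cycle_cyclic s)) //; last first.
  by rewrite cycle_subG !groupX // cycle_id.
have k0 : (0 < k)%N.
  by move: kE (finNzRing_gt1 F); case: (k) => //; rewrite mul0n; case: #|F| => [|[]].
have E : #|F|.-1 = (y * (k * 2))%N by rewrite -kE -muln2 mulnCA.
rewrite -orderE -expgM orderXdiv s_ord E.
  by rewrite mulnK ?muln_gt0 ?k0.
by rewrite dvdn_mull.
Qed.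

End Center.

Theorem theorem11p2 (F : finFieldType) (n : nat) (Y : {group {'GL_n[F]}}) :
  (0 < n)%N ->
  Y \subset ('Z(SL n F))%g ->
  (1 < #|Y|`_2)%N ->
  (#|Y|`_2 < (gcdn n #|F|.-1)`_2)%N ->
  #|real_classes (SL n F / Y)%g| = #|strongly_real_classes (SL n F / Y)%g|
  /\ (#|real_classes (SL n F / Y)%g|%:R =
      \sum_(nu : {ffun 'I_n.+1 -> 'I_n.+1} | is_partition nu)
        (h_part #|F| nu)%:R * sl_part #|F| nu :> rat)%R.
Proof.
case: n Y => // m Y _ sYZ Y2 Y2g; set g := gcdn _ _ in Y2g.
have dvd2_part k : (1 < k`_2 -> 2 %| k)%N.
  move=> k2; have : (0 < logn 2 k)%N by move: k2; rewrite p_part; case: (logn 2 k).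
  by rewrite logn_gt0 mem_primes => /and3P [].
have q1 : (0 < #|F|.-1)%N by have := finNzRing_gt1 F; case: #|F| => [|[]].
have g0 : (0 < g)%N by rewrite gcdn_gt0.
have Y0 := cardG_gt0 Y.
have Yg : (#|Y| %| g)%N := center_SL_order sYZ.
(* Write [g] as [k] times [#|Y|]: the strict inequality between 2-parts says that [k] is even. *)
have Y2_g : (#|Y|.*2 %| g)%N.
  have [k gE] := dvdnP Yg; rewrite gE -mul2n mulnC [X in (_ %| X)%N]mulnC dvdn_pmul2l //.
  have k0 : (0 < k)%N by move: g0; rewrite gE muln_gt0 => /andP [].
  move: Y2g; rewrite gE partnM // -{1}[(#|Y|`_2)%N]mul1n ltn_pmul2r ?part_gt0 //.
  exact: dvd2_part.
have even_Y : (2 %| #|Y|)%N := dvd2_part _ Y2.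
have [n_dvd q_dvd] : (#|Y|.*2 %| m.+1)%N /\ (#|Y|.*2 %| #|F|.-1)%N.
  by apply/andP; rewrite -dvdn_gcd.
have n4 : (4 %| m.+1)%N.
  by apply: dvdn_trans n_dvd; rewrite -muln2; apply: (dvdn_mul even_Y (dvdnn 2)).
have two_neq0 : (1 + 1 : F) != 0.
  have q_even : (2 %| #|F|.-1)%N by apply: dvdn_trans q_dvd; rewrite -muln2 dvdn_mull.
  apply/negP => /eqP F2; have F2' : 2 \in [pchar F] by apply/andP; split=> //; rewrite mulr2n F2 eqxx.
  have := abelem_pgroup (fin_ring_pchar_abelem F2'); rewrite /pgroup cardsT => q2.
  have : (2%N)^'.-nat #|F|.
    rewrite -odd_2'nat; move: q_even; rewrite dvdn2 -(prednK (ltnW (finNzRing_gt1 F))) /=.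
    by [].
  by move/(pnat_1 q2) => q_1; have := finNzRing_gt1 F; rewrite q_1.
have [alpha alphaZ YE] := center_SL_squares sYZ n_dvd q_dvd.
split.
  congr #|pred_of_set _|; apply/esym.
  apply: (strongly_real_classes_quotient (G := SL_group m.+1 F) alphaZ YE).
  by move=> x; apply: strongly_real_SL.
rewrite -(sum_type_gcd m two_neq0) -card_real_classes_SL //; congr _%:R.
exact: (card_real_classes_quotient (G := SL_group m.+1 F) alphaZ YE).
Qed.
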